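(* (Identity Principle) Let $\Omega$ be a $(1,3)$-slice domain in $\mathbb{H}$ and let $f,g:\Omega\to\mathbb{H}$ be $(1,3)$-regular functions. If there exist $J_0\in\mathbb{S}^1$ and a subset of $\Omega_{J_0}$ whose interior (in $\mathbb{R}^{2+1}_{J_0}$) is not empty (or whose Hausdorff dimension is greater than $2$) where $f$ and $g$ coincide, then $f=g$ throughout $\Omega$.
   Context: $\mathbb{H}=\mathbb{R}+i\mathbb{R}+j\mathbb{R}+k\mathbb{R}$ is the algebra of real quaternions; $\mathbb{C}:=\mathbb{R}+i\mathbb{R}\subset\mathbb{H}$; $\mathbb{S}^1:=\{jb+kc: b,c\in\mathbb{R},\ b^2+c^2=1\}$. For $J\in\mathbb{S}^1$, $\mathbb{R}^{2+1}_J:=\mathrm{Span}_{\mathbb{R}}(1,i,J)$, with points written $x_0+ix_1+\beta J$ ($x_0,x_1,\beta\in\mathbb{R}$). For $V\subseteq\mathbb{R}^{2+1}_J$ open, a $C^1$ function $\phi:V\to\mathbb{H}$ is $J$-monogenic if $(\partial_{x_0}+i\partial_{x_1}+J\partial_\beta)\phi(x_0+ix_1+\beta J)\equiv0$ on $V$ (left multiplication). A domain $\Omega$ in $\mathbb{H}$ is a nonempty connected open subset; $\Omega_J:=\Omega\cap\mathbb{R}^{2+1}_J$ and, for $f:\Omega\to\mathbb{H}$, $f_J:=f|_{\Omega_J}$. The function $f$ is $(1,3)$-regular if $f_J$ is $J$-monogenic for every $J\in\mathbb{S}^1$. A domain $\Omega$ is a $(1,3)$-slice domain if $\Omega\cap\mathbb{C}\neq\emptyset$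 and $\Omega_J$ is connected for every $J\in\mathbb{S}^1$. *)

(* Defs.v *)
From HB Require Import structures.
From mathcomp Require Import all_boot all_order all_algebra.
From mathcomp Require Import ring.
From mathcomp Require Import all_classical all_reals all_analysis.

Set Implicit Arguments.
Unset Strict Implicit.
Unset Printing Implicit Defensive.

Import Order.TTheory GRing.Theory Num.Theory.
Import numFieldNormedType.Exports.

Local Open Scope classical_set_scope.
Local Open Scope ring_scope.

(* The entries of a quaternion are its coordinates on 1, i, j, k. The topology
   and the vector-space structure are those of R^4. The norm `|q| inherited
   from row vectors is the sup norm, not the Euclidean modulus: the latter is
   qnorm below. *)
Definition quaternion (R : realType) : Type := 'rV[R]_4.

HB.instance Definition _ (R : realType) :=
  NormedModule.copy (quaternion R) 'rV[R]_4.

Section QuaternionRing.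
Context {R : realType}.
Implicit Types p q r : quaternion R.

Definition mkq (a b c d : R) : quaternion R :=
  \row_(m < 4) [:: a; b; c; d]`_m.

Lemma quaternionP p q :
  p 0 0 = q 0 0 -> p 0 1 = q 0 1 -> p 0 2 = q 0 2 -> p 0 3 = q 0 3 -> p = q.
Proof.
move=> e0 e1 e2 e3; apply/rowP => m.
have [->|[->|[->|->]]] // : m = 0 \/ m = 1 \/ m = 2 \/ m = 3.
by case: m => [[|[|[|[|//]]]] ?];
   [left|right; left|right; right; left|right; right; right]; apply/val_inj.
Qed.

Lemma mkqE (a b c d : R) :
  (mkq a b c d 0 0 = a) * (mkq a b c d 0 1 = b) *
  (mkq a b c d 0 2 = c) * (mkq a b c d 0 3 = d).
Proof. by rewrite /mkq !mxE. Qed.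

Lemma qDE p q m : (p + q) 0 m = p 0 m + q 0 m.
Proof. exact: mxE. Qed.

Lemma qNE p m : (- p) 0 m = - p 0 m.
Proof. exact: mxE. Qed.

Lemma qZE (a : R) p m : (a *: p) 0 m = a * p 0 m.
Proof. exact: mxE. Qed.

Definition qone : quaternion R := mkq 1 0 0 0.
Definition qi : quaternion R := mkq 0 1 0 0.
Definition qj : quaternion R := mkq 0 0 1 0.
Definition qk : quaternion R := mkq 0 0 0 1.

Definition qmul p q : quaternion R :=
  mkq (p 0 0 * q 0 0 - p 0 1 * q 0 1 - p 0 2 * q 0 2 - p 0 3 * q 0 3)
      (p 0 0 * q 0 1 + p 0 1 * q 0 0 + p 0 2 * q 0 3 - p 0 3 * q 0 2)
      (p 0 0 * q 0 2 - p 0 1 * q 0 3 + p 0 2 * q 0 0 + p 0 3 * q 0 1)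
      (p 0 0 * q 0 3 + p 0 1 * q 0 2 - p 0 2 * q 0 1 + p 0 3 * q 0 0).

Lemma qmulA : associative qmul.
Proof. by move=> p q r; apply: quaternionP; rewrite /qmul /qone !mkqE; ring. Qed.

Lemma qmul1l : left_id qone qmul.
Proof. by move=> q; apply: quaternionP; rewrite /qmul /qone !mkqE; ring. Qed.

Lemma qmul1r : right_id qone qmul.
Proof. by move=> q; apply: quaternionP; rewrite /qmul /qone !mkqE; ring. Qed.

Lemma qmulDl : left_distributive qmul +%R.
Proof. by move=> p q r; apply: quaternionP; rewrite /qmul !(mkqE, qDE, qZE); ring. Qed.

Lemma qmulDr : right_distributive qmul +%R.
Proof. by move=> p q r; apply: quaternionP; rewrite /qmul !(mkqE, qDE, qZE); ring. Qed.

Lemma qone_neq0 : qone != 0.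
Proof.
by apply/eqP => /rowP/(_ 0)/eqP; rewrite mkqE mxE oner_eq0.
Qed.

Lemma qscaleAl (a : R) p q : a *: qmul p q = qmul (a *: p) q.
Proof. by apply: quaternionP; rewrite /qmul !(mkqE, qDE, qZE); ring. Qed.

Lemma qscaleAr (a : R) p q : a *: qmul p q = qmul p (a *: q).
Proof. by apply: quaternionP; rewrite /qmul !(mkqE, qDE, qZE); ring. Qed.

End QuaternionRing.

HB.instance Definition _ (R : realType) :=
  GRing.Zmodule_isNzRing.Build (quaternion R)
    (@qmulA R) (@qmul1l R) (@qmul1r R) (@qmulDl R) (@qmulDr R) (@qone_neq0 R).
HB.instance Definition _ (R : realType) :=
  GRing.Lmodule_isLalgebra.Build R (quaternion R) (@qscaleAl R).
HB.instance Definition _ (R : realType) :=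
  GRing.Lalgebra_isAlgebra.Build R (quaternion R) (@qscaleAr R).

Section QuaternionRelations.
Context {R : realType}.

Lemma q1E : 1 = mkq 1 0 0 0 :> quaternion R.
Proof. by []. Qed.

Lemma qME (p q : quaternion R) : p * q = qmul p q.
Proof. by []. Qed.

Lemma qi_sqr : qi * qi = -1 :> quaternion R.
Proof. by apply: quaternionP; rewrite !qME q1E /qmul /qi /qj /qk !(qNE, mkqE); ring. Qed.

Lemma qj_sqr : qj * qj = -1 :> quaternion R.
Proof. by apply: quaternionP; rewrite !qME q1E /qmul /qi /qj /qk !(qNE, mkqE); ring. Qed.

Lemma qk_sqr : qk * qk = -1 :> quaternion R.
Proof. by apply: quaternionP; rewrite !qME q1E /qmul /qi /qj /qk !(qNE, mkqE); ring. Qed.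

Lemma qijk : qi * qj * qk = -1 :> quaternion R.
Proof. by apply: quaternionP; rewrite !qME q1E /qmul /qi /qj /qk !(qNE, mkqE); ring. Qed.

End QuaternionRelations.

Section Hausdorff.
Context {R : realType} {T : Type} (d : T -> T -> R).

(* maxe 0 only serves to make the diameter of the empty set 0. *)
Definition diameter (U : set T) : \bar R :=
  maxe 0%E (ereal_sup [set e | exists x y, [/\ U x, U y & e = (d x y)%:E]]).

Definition hausdorff_premeasure (s delta : R) (S : set T) : \bar R :=
  ereal_inf [set e | exists U : nat -> set T,
    [/\ S `<=` \bigcup_n U n,
        forall n, (diameter (U n) <= delta%:E)%E
      & e = (\sum_(0 <= n <oo) diameter (U n) `^ s)%E]].

Definition hausdorff_measure (s : R) (S : set T) : \bar R :=
  ereal_sup [set hausdorff_premeasure s delta S | delta in [set x : R | 0 < x]].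

(* Restricting to 0 < s avoids the convention on 0 `^ 0 and leaves the infimum
   unchanged. *)
Definition hausdorff_dim (S : set T) : \bar R :=
  ereal_inf [set s%:E | s in [set s : R | 0 < s /\ hausdorff_measure s S = 0%E]].

End Hausdorff.

Section Slices.
Context {R : realType}.
Local Notation H := (quaternion R).

Definition qnorm (q : H) : R := Num.sqrt (\sum_(m < 4) q 0 m ^+ 2).
Definition qdist (p q : H) : R := qnorm (p - q).

Definition complex_plane : set H :=
  [set q | exists a b : R, q = a%:A + b *: qi].

Definition sphere1 : set H :=
  [set J | exists b c : R, J = b *: qj + c *: qk /\ b ^+ 2 + c ^+ 2 = 1].

Definition slice_space (J : H) : set H :=
  [set q | exists x0 x1 beta : R, q = x0%:A + x1 *: qi + beta *: J].

Definition slice (Omega : set H) (J : H) : set H := Omega `&` slice_space J.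

(* V is meant to be a relatively open subset of slice_space J. The partial
   derivatives of phi(x0 + i x1 + beta J) in x0, x1 and beta are the
   directional derivatives along 1, qi and J, so they only depend on the
   values of phi on V. *)
Definition C1_on (J : H) (V : set H) (phi : H -> H) :=
  forall v, v \in [:: 1; qi; J] ->
    (forall q, V q -> derivable phi q v) /\ {within V, continuous ('D_v phi)}.

Definition monogenic (J : H) (V : set H) (phi : H -> H) :=
  C1_on J V phi /\
  forall q, V q -> 'D_1 phi q + qi * 'D_qi phi q + J * 'D_J phi q = 0.

Definition is_domain (Omega : set H) :=
  [/\ Omega !=set0, connected Omega & open Omega].

(* A function Omega -> H is represented by a total function whose values
   outside Omega are irrelevant. *)
Definition regular13 (Omega : set H) (f : H -> H) :=
  forall J, sphere1 J -> monogenic J (slice Omega J) f.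

Definition slice_domain13 (Omega : set H) :=
  [/\ is_domain Omega, Omega `&` complex_plane !=set0
    & forall J, sphere1 J -> connected (slice Omega J)].

Definition slice_interior (J : H) (S : set H) : set H :=
  interior (S : set (subspace (slice_space J))).

(* subspace A makes the points outside A isolated, so this is the interior in
   the topology of slice_space J only for S included in slice_space J. *)
Lemma slice_interiorP (J : H) (S : set H) (q : H) : S `<=` slice_space J ->
  slice_interior J S q <->
  slice_space J q /\ exists U, [/\ open U, U q & U `&` slice_space J `<=` S].
Proof.
move=> sS; have nbE : slice_space J q -> slice_interior J S q =
    within (slice_space J) (nbhs q) S.
  by move=> qJ; rewrite (nbhs_subspace_in qJ).
split=> [Sq | [qJ [U [oU Uq US]]]].
  have qJ : slice_space J q by exact/sS/(nbhs_subspace_singleton Sq).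
  split=> //; move: Sq; rewrite nbE // /within /= nbhsE => -[U [oU Uq] US].
  by exists U; split=> // p [Up Jp]; exact: US.
rewrite nbE // /within /= nbhsE; exists U => // p Up Jp; exact: US.
Qed.

End Slices.

(* Main.v *)
Require Import Defs.
From HB Require Import structures.
From mathcomp Require Import all_boot all_order all_algebra.
From mathcomp Require Import ring lra.
From mathcomp Require Import all_classical all_reals all_analysis.

(** Fix J in the sphere. In the coordinates (x0, x1, beta) the slice is an open
    subset of R^3 and the four real components of a J-monogenic function form a
    C^1 solution of a system sum_k a_k d_k F = 0, where a_k is the matrix of left
    multiplication by 1, i or J. With b_k the matrix of the conjugate of that
    unit, b_k a_l + b_l a_k = 2 delta_kl, so the system is a factor of the
    Laplacian. Most of the file studies such systems in R^n.

    Solutions have the unique continuation property of analytic functions. It is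
    obtained from one estimate, [gradient_bound]: |d_k F(p)| <= (n + 1) M / r if
    |F| <= M on the cube of half-side r around p. Averages of F over small cubes
    are C^2, hence componentwise harmonic ([dirac_harmonic]); for harmonic
    functions the estimate follows from the maximum principle, by comparing the
    odd part in the direction k with a quadratic barrier ([harmonic_odd_bound]);
    it then passes to the limit. Difference quotients of F are solutions as well,
    and the estimate makes their derivatives converge: F is smooth and its
    derivatives are solutions ([dirac_solution_partial]). Iterating the estimate
    m times with radius r / (m + 1) bounds the derivatives of order m by
    (C m / r)^m M, so the Taylor remainder tends to 0 near p and a solution which
    is flat at p, meaning that all its derivatives vanish there, vanishes around
    p ([flat_nbhs]). The flat points form a subset that is open and closed in the
    slice; as the slice is connected, one flat point of f - g is enough to have
    f = g on all of it ([slice_eq_of_flat]).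

    A flat point of f - g arises in three ways. If f = g on an open piece of the
    slice, all its points are flat. If f = g on an open piece of the complex
    plane, the derivatives in x0 and x1 vanish there and the system expresses
    d_beta through them ([flat_of_hyperplane]). If f = g on a set without flat
    points, then at each of its points some iterated derivative of a component
    vanishes and has a nonzero gradient; the zeros of this kind of one function
    form locally a Lipschitz graph over part of a square, and there are countably
    many functions, so the dimension of the set is at most 2
    ([not_flat_zero_set_null]).

    Hence f = g on the slice of J0, in particular on the intersection of Omega
    with the complex plane. This intersection is nonempty and lies in every
    slice, so f = g on every slice, and the slices cover Omega. *)

Set Implicit Arguments.
Unset Strict Implicit.
Unset Printing Implicit Defensive.

Import Order.TTheory GRing.Theory Num.Theory.
Import numFieldNormedType.Exports.

Local Open Scope classical_set_scope.
Local Open Scope ring_scope.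

(** * Derivatives along lines and partial derivatives *)

Section Lines.
Context {R : realType} {V : normedModType R}.
Implicit Types (u : V -> R) (x v : V) (s t : R).

Lemma is_derive_line u x v t : derivable u (x + t *: v) v ->
  is_derive t 1 (fun s => u (x + s *: v)) ('D_v u (x + t *: v)).
Proof.
have E : (fun h : R => h^-1 *: (((fun s => u (x + s *: v)) \o shift t) (h *: 1) -
                         u (x + t *: v))) =
         (fun h => h^-1 *: ((u \o shift (x + t *: v)) (h *: v) - u (x + t *: v))).
  apply/funext => h /=; congr (_ *: (u _ - _)).
  by rewrite [_%:A]mulr1 scalerDl addrCA.
move=> du; apply: DeriveDef; first by rewrite /derivable E.
by rewrite /derive E.
Qed.

(** The intermediate point is given by its ratio to s, so that both signs of s
    are covered. *)
Lemma mvt_line u x v s :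
  (forall a, 0 <= a <= 1 -> derivable u (x + (a * s) *: v) v) ->
  exists2 a, 0 <= a <= 1 & u (x + s *: v) - u x = 'D_v u (x + (a * s) *: v) * s.
Proof.
move=> du.
have dl a : 0 <= a <= 1 -> is_derive (a * s) 1 (fun s => u (x + s *: v))
      ('D_v u (x + (a * s) *: v)) by move=> /du /is_derive_line.
have u0 : u x = u (x + 0 *: v) by rewrite scale0r addr0.
have [->|s0] := eqVneq s 0.
  by exists 0; rewrite ?lexx ?ler01// -u0 subrr mulr0.
have dt (t : R) : 0 <= t / s <= 1 ->
    is_derive t 1 (fun s => u (x + s *: v)) ('D_v u (x + t *: v)).
  by move=> /dl; rewrite divfK.
have ct (a b : R) : (forall t, t \in `[a, b] -> 0 <= t / s <= 1) ->
    {within `[a, b], continuous (fun s => u (x + s *: v))}.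
  move=> H; apply: derivable_within_continuous => t tab.
  by apply: ex_derive; apply: dt; exact: H.
have [sp|sn] : 0 < s \/ s < 0 by case: (ltgtP s 0) s0; [right|left|].
  have I (t : R) : t \in `[0, s] -> 0 <= t / s <= 1.
    rewrite in_itv/= => /andP[t0 ts].
    by rewrite divr_ge0 ?(ltW sp)//= ler_pdivrMr// mul1r.
  have J (t : R) : t \in `]0, s[ ->
    is_derive t 1 (fun s => u (x + s *: v)) ('D_v u (x + t *: v)).
    by move=> ts; apply/dt/I; apply: subset_itv_oo_cc.
  have [c /subset_itv_oo_cc cs] := MVT sp J (ct _ _ I).
  rewrite -u0 subr0 => E.
  by exists (c / s); rewrite ?I// divfK.
have I (t : R) : t \in `[s, 0] -> 0 <= t / s <= 1.
  rewrite in_itv/= => /andP[t0 ts].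
  by rewrite ler_ndivrMr// ler_ndivlMr// mul0r mul1r ts t0.
have J (t : R) : t \in `]s, 0[ ->
  is_derive t 1 (fun s => u (x + s *: v)) ('D_v u (x + t *: v)).
  by move=> ts; apply/dt/I; apply: subset_itv_oo_cc.
have [c /subset_itv_oo_cc cs] := MVT sn J (ct _ _ I).
rewrite -u0 sub0r mulrN => E.
by exists (c / s); rewrite ?I// divfK// -[RHS]opprK -E opprB.
Qed.

End Lines.

Section Coordinates.
Context {R : realType} {n : nat}.
Local Notation X := 'rV[R]_n.
Implicit Types (u : X -> R) (x y z p : X) (k : 'I_n).

Definition axis k : X := delta_mx 0 k.
Definition partial k u : X -> R := 'D_(axis k) u.

Lemma ball_rVP p r y : ball p r y <-> 0 < r /\ forall i, `|p 0 i - y 0 i| < r.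
Proof.
split=> [[r0 H]|[r0 H]]; split => // i; first exact: H.
by move=> j; rewrite (ord1 i); exact: H.
Qed.

Lemma ltr_norm_conv (a b c r : R) : 0 <= a <= 1 -> `|b| < r -> `|c| < r ->
  `|(1 - a) * b + a * c| < r.
Proof.
move=> /andP[a0 a1] br cr; apply: (le_lt_trans (ler_normD _ _)).
rewrite !normrM (ger0_norm a0) (ger0_norm (_ : 0 <= 1 - a)) ?subr_ge0//.
have [->|an0] := eqVneq a 0; first by rewrite subr0 mul1r mul0r addr0.
have {}a0 : 0 < a by rewrite lt_def an0.
have -> : r = (1 - a) * r + a * r by ring.
apply: ler_ltD; last by rewrite ltr_pM2l.
by rewrite ler_wpM2l ?subr_ge0// ltW.
Qed.

(** Balls of the sup norm are cubes, so the path from x to y that changes one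
    coordinate at a time stays in the ball; the mean value theorem applies to each
    of its edges. *)
Lemma lipschitz_box u p r (B : R) :
  (forall k x, ball p r x -> derivable u x (axis k) /\ `|partial k u x| <= B) ->
  forall x y, ball p r x -> ball p r y ->
    `|u y - u x| <= B * \sum_i `|y 0 i - x 0 i|.
Proof.
move=> du x y /ball_rVP[r0 px] /ball_rVP[_ py].
pose z (j : nat) : X := \row_i (if (i < j)%N then y 0 i else x 0 i).
suff H j : (j <= n)%N -> `|u (z j) - u x| <=
  B * \sum_(i < n | (i < j)%N) `|y 0 i - x 0 i|.
  have := H n (leqnn n); rewrite (_ : z n = y).
    rewrite (eq_bigl xpredT)// => i; exact: ltn_ord.
  by apply/rowP => i; rewrite mxE ltn_ord.
elim: j => [_|j IH jn].
  rewrite (_ : z 0%N = x) ?subrr ?normr0 ?big_pred0 ?mulr0//.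
  by apply/rowP => i; rewrite mxE.
pose k := Ordinal jn.
have zS : z j.+1 = z j + (y 0 k - x 0 k) *: axis k.
  apply/rowP => i; rewrite !mxE eqxx/= ltnS leq_eqVlt.
  have [->|ik] := eqVneq i k; first by rewrite /= eqxx ltnn mulr1 addrCA subrr addr0.
  by rewrite (_ : (i == j :> nat) = false) ?mulr0 ?addr0//; apply/negbTE.
have bz a : 0 <= a <= 1 -> ball p r (z j + (a * (y 0 k - x 0 k)) *: axis k).
  move=> a01; apply/ball_rVP; split => // i.
  rewrite !mxE eqxx/=.
  have [->|ik] := eqVneq i k; last by rewrite mulr0 addr0; case: ifP.
  rewrite /= ltnn mulr1.
  have -> : p 0 k - (x 0 k + a * (y 0 k - x 0 k)) =
     (1 - a) * (p 0 k - x 0 k) + a * (p 0 k - y 0 k) by ring.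
  exact: ltr_norm_conv.
have [a a01 E] := @mvt_line _ _ u (z j) (axis k) (y 0 k - x 0 k)
   (fun a a01 => (du k _ (bz a a01)).1).
rewrite (bigD1 k)//= mulrDr zS.
have -> : u (z j + (y 0 k - x 0 k) *: axis k) - u x =
  (u (z j + (y 0 k - x 0 k) *: axis k) - u (z j)) + (u (z j) - u x) by ring.
apply: (le_trans (ler_normD _ _)); apply: lerD.
  by rewrite E normrM ler_wpM2r// ; exact: (du k _ (bz a a01)).2.
apply: (le_trans (IH (ltnW jn))); rewrite le_eqVlt; apply/orP; left; apply/eqP.
congr (_ * _); apply: eq_bigl => i; rewrite [in RHS]ltnS [in RHS]leq_eqVlt.
have [->|ik] := eqVneq i k; first by rewrite andbF ltnn.
by rewrite andbT (_ : (i == j :> nat) = false)//; apply/negbTE.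
Qed.

Lemma continuous_ballP u x : {for x, continuous u} <->
  forall e, 0 < e -> exists2 d, 0 < d & forall y, ball x d y -> `|u y - u x| < e.
Proof.
split=> [cu e e0|H].
  have /nbhs_ballP[d /= d0 dH] : nbhs x [set y | `|u y - u x| < e].
    have /cvgrPdist_lt/(_ e e0) := cu.
    by apply: filterS => y /=; rewrite distrC.
  by exists d => // y /dH.
have C : u y @[y --> nbhs x] --> u x.
  apply/(@cvgrPdist_lt _ _ _ (nbhs x)) => e /H[d d0 dH].
  by apply/nbhs_ballP; exists d => //= y /dH; rewrite distrC.
exact: C.
Qed.

Definition C1_partials (W : set X) u := forall k x, W x ->
  derivable u x (axis k) /\ {for x, continuous (partial k u)}.

Lemma C1_partial_bounded W u x : C1_partials W u -> nbhs x W ->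
  exists B, nbhs x [set y | forall k, `|partial k u y| <= B].
Proof.
move=> C1 Wx; exists (\sum_k (`|partial k u x| + 1)).
suff H k : nbhs x [set y | `|partial k u y| <= \sum_i (`|partial i u x| + 1)].
  exact: (@filter_forall _ _ (fun k y =>
    `|partial k u y| <= \sum_i (`|partial i u x| + 1)) _ _ H).
have /continuous_ballP/(_ _ ltr01)[d d0 H] := (C1 k x (nbhs_singleton Wx)).2.
apply/nbhs_ballP; exists d => //= y /H {}H.
rewrite (bigD1 k)//= -[leLHS]addr0 lerD//; last by rewrite sumr_ge0// => i _;
  rewrite addr_ge0.
rewrite -[partial k u y](subrK (partial k u x)).
by apply: (le_trans (ler_normD _ _)); rewrite addrC lerD2l ltW.
Qed.

(** Locally bounded partial derivatives make u locally Lipschitz. *)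
Lemma C1_continuous W u x : C1_partials W u -> nbhs x W -> {for x, continuous u}.
Proof.
move=> C1 Wx; have [B HB] := C1_partial_bounded C1 Wx.
have /nbhs_ballP[r /= r0 Br] :
    nbhs x (W `&` [set y | forall k, `|partial k u y| <= B]).
  exact: filterI.
have xr : ball x r x by exact: ballxx.
have L y : ball x r y -> `|u y - u x| <= B * \sum_i `|y 0 i - x 0 i|.
  move=> yr; apply: (@lipschitz_box u x r B _ x y xr yr) => k z /Br[Wz /(_ k)].
  by split => //; exact: (C1 k z Wz).1.
apply/continuous_ballP => e e0.
pose K := `|B| * n%:R + 1.
have K0 : 0 < K by rewrite ltr_wpDl// mulr_ge0.
exists (Num.min r (e / K)); first by rewrite lt_min r0 divr_gt0.
move=> y /ball_rVP[_ xy].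
have yr : ball x r y.
  by apply/ball_rVP; split => // i; have := xy i; rewrite lt_min => /andP[].
apply: (le_lt_trans (L _ yr)).
have /le_lt_trans -> // : B * \sum_i `|y 0 i - x 0 i| <= (`|B| * n%:R) * (e / K).
  apply: (@le_trans _ _ (`|B| * \sum_i `|y 0 i - x 0 i|)).
    by rewrite ler_wpM2r ?ler_norm// sumr_ge0.
  rewrite -mulrA ler_wpM2l// mulr_natl -[n in _ *+ n]card_ord -sumr_const.
  apply: ler_sum => i _; have := xy i; rewrite lt_min distrC => /andP[_ /ltW].
  by [].
by rewrite mulrCA gtr_pMr// ltr_pdivrMr// mul1r /K ltrDl.
Qed.

End Coordinates.

(** * Averages along segments *)

Section UnitMean.
Context {R : realType}.
Local Notation mu := (@lebesgue_measure R).
Implicit Types f g : R -> R.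

Definition unit_mean f : R := \int[mu]_(s in `[0, 1]) f s.

Local Notation cts01 f := {within `[0, 1], continuous (f : R -> R)}.

Lemma cts01_integrable f : cts01 f -> mu.-integrable `[0, 1] (EFin \o f).
Proof. by move=> cf; apply: continuous_compact_integrable => //;
  exact: segment_compact. Qed.

Lemma unit_mean_cst c : unit_mean (fun=> c) = c.
Proof.
rewrite /unit_mean Rintegral_cst//= lebesgue_measure_itv/= lte01.
by rewrite oppr0 adde0/= mulr1.
Qed.

Lemma le_unit_mean f g : cts01 f -> cts01 g ->
  (forall s : R, 0 <= s <= 1 -> f s <= g s) -> unit_mean f <= unit_mean g.
Proof.
move=> cf cg fg.
exact: (le_Rintegral _ (cts01_integrable cf) (cts01_integrable cg)).
Qed.

Lemma unit_meanB f g : cts01 f -> cts01 g ->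
  unit_mean (fun s => f s - g s) = unit_mean f - unit_mean g.
Proof.
move=> cf cg.
exact: (RintegralB _ (cts01_integrable cf) (cts01_integrable cg)).
Qed.

Lemma unit_meanD f g : cts01 f -> cts01 g ->
  unit_mean (fun s => f s + g s) = unit_mean f + unit_mean g.
Proof.
move=> cf cg.
exact: (RintegralD _ (cts01_integrable cf) (cts01_integrable cg)).
Qed.

Lemma unit_meanZ c f : cts01 f -> unit_mean (fun s => c * f s) = c * unit_mean f.
Proof. by move=> cf; exact: (RintegralZl _ _ (cts01_integrable cf)). Qed.

Lemma eq_unit_mean f g : (forall s : R, 0 <= s <= 1 -> f s = g s) ->
  unit_mean f = unit_mean g.
Proof.
move=> fg; apply: eq_Rintegral => s; rewrite inE/= in_itv/=; exact: fg.
Qed.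

Lemma unit_mean_bounds f a b : cts01 f -> (forall s : R, 0 <= s <= 1 ->
  a <= f s <= b) ->
  a <= unit_mean f <= b.
Proof.
move=> cf fab; have cc (c : R) : cts01 (fun=> c).
  by apply: continuous_subspaceT => ?; exact: cst_continuous.
rewrite -[X in X <= _ <= _]unit_mean_cst -[X in _ <= _ <= X]unit_mean_cst.
by rewrite !le_unit_mean// => s /fab/andP[].
Qed.

Lemma unit_mean_close f g e : cts01 f -> cts01 g ->
  (forall s : R, 0 <= s <= 1 -> `|f s - g s| <= e) ->
  `|unit_mean f - unit_mean g| <= e.
Proof.
move=> cf cg fg; rewrite -unit_meanB// ler_norml; apply: unit_mean_bounds.
  by move=> s; apply: cvgB; [exact: cf|exact: cg].
by move=> s /fg; rewrite ler_norml.
Qed.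

Lemma unit_mean_derivative f g : cts01 g ->
  (forall s : R, 0 <= s <= 1 -> is_derive s 1 f (g s)) -> unit_mean g = f 1 - f 0.
Proof.
move=> cg fg.
have cf (s : R) : 0 <= s <= 1 -> {for s, continuous f}.
  move=> s01; apply: differentiable_continuous; apply/derivable1_diffP.
  by have [] := fg s s01.
rewrite /unit_mean /Rintegral (@continuous_FTC2 _ g f)// ?EFinN //.
- split.
  + by move=> x; rewrite in_itv/= => /andP[x0 x1]; have [] := fg x;
    rewrite ?(ltW x0) ?(ltW x1).
  + by apply: cvg_at_right_filter; apply: cf; rewrite lexx ler01.
  + by apply: cvg_at_left_filter; apply: cf; rewrite lexx ler01.
- move=> x; rewrite inE => /andP[x0 x1]; rewrite derive1E.
  by have [] := fg x; rewrite ?(ltW x0) ?(ltW x1).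
Qed.

End UnitMean.

Section Averages.
Context {R : realType} {n : nat}.
Local Notation X := 'rV[R]_n.
Implicit Types (u : X -> R) (x y z p : X) (k : 'I_n) (h r : R).

Definition closed_cube p r : set X := [set y | forall i, `|p 0 i - y 0 i| <= r].

Lemma closed_cube_compact p r : compact (closed_cube p r).
Proof.
have := @rV_compact R n (fun i => `[p 0 i - r, p 0 i + r]%classic)
   (fun i => @segment_compact _ _ _).
congr compact; apply/seteqP; split => y H i; have := H i;
  rewrite /= in_itv/= ler_distlC => /andP[? ?].
by apply/andP; split; lra.
by apply/andP; split; lra.
Qed.

Lemma closed_cube_ball p r x s y : 0 <= s -> ball p r x -> closed_cube x s y ->
  ball p (r + s) y.
Proof.
move=> s0 /ball_rVP[r0 px] xy; apply/ball_rVP; split; first by rewrite ltr_wpDr.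
move=> i; rewrite -(subrKA (x 0 i)); apply: (le_lt_trans (ler_normD _ _)).
by rewrite ltr_leD.
Qed.

Lemma closed_cube_segment x k s h : 0 <= h -> 0 <= s <= 1 ->
  closed_cube x h (x + (s * h) *: axis k).
Proof.
move=> h0 /andP[s0 s1] i.
rewrite !mxE eqxx/= opprD addrA subrr sub0r normrN.
rewrite normrM ger0_norm ?mulr_ge0// -[leRHS]mulr1 ler_pM ?mulr_ge0//.
  by rewrite -[leRHS]mul1r ler_wpM2r.
by case: eqP; rewrite ?normr1 ?normr0.
Qed.

Lemma uniform_continuity u (K : set X) : compact K ->
  (forall x, K x -> {for x, continuous u}) ->
  forall e, 0 < e -> exists2 d, 0 < d &
    forall x y, K x -> ball x d y -> `|u y - u x| < e.
Proof.
move=> /compact_near_coveringP cK cu e e0.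
have := cK R 0^'+ (fun d x => forall y, ball x d y -> `|u y - u x| < e) _ _.
case.
  move=> x /cu/continuous_ballP/(_ (e / 2)); rewrite divr_gt0// => /(_ isT)[d d0 H].
  exists (ball x (d / 2), [set t | t < d / 2]).
    split; first by apply: nbhsx_ballx; rewrite divr_gt0.
    by apply: nbhs_right_lt; rewrite divr_gt0.
  move=> [x' t] /= [xx' td] y x'y.
  rewrite (_ : u y - u x' = (u y - u x) + (u x - u x')); last by ring.
  apply: (le_lt_trans (ler_normD _ _)); rewrite (splitr e) ltrD//.
    apply: H; rewrite (splitr d); apply: ball_triangle xx' _.
    by apply: le_ball x'y; exact: ltW.
  by rewrite distrC; apply: H; apply: le_ball xx';
    rewrite ler_pdivrMr// ler_peMr ?ler1n// ltW.
move=> d /= d0 H; exists (d / 2); first by rewrite divr_gt0.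
move=> x y Kx; apply: (H (d / 2)) => //=; rewrite ?divr_gt0//.
by rewrite /ball/= sub0r normrN gtr0_norm ?divr_gt0// gtr_pMr// invf_lt1 ?ltr1n.
Qed.

Lemma is_derive_of_bound u x v (l : R) :
  (forall e, 0 < e -> exists2 d, 0 < d &
     forall t, `|t| < d -> `|u (x + t *: v) - u x - t * l| <= e * `|t|) ->
  is_derive x v u l.
Proof.
move=> H.
have C : h^-1 *: ((u \o shift x) (h *: v) - u x) @[h --> 0^'] --> l.
  apply/cvgrPdist_le => e e0; have [d d0 {}H] := H e e0.
  exists d => //= t /=; rewrite sub0r normrN => td t0.
  have tn0 : `|t| != 0 by rewrite normr_eq0.
  rewrite distrC [t *: v + x]addrC.
  rewrite (_ : _ - l = (u (x + t *: v) - u x - t * l) / t).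
    by rewrite normrM normfV ler_pdivrMr ?normr_gt0//; exact: H.
  by rewrite mulrBl mulrAC divff// mul1r [_ *: _]mulrC.
by apply: DeriveDef; [apply: cvgP C|exact: cvg_lim C].
Qed.

(** Averaging one direction at a time gives access to averages over cubes without
    any exchange of integrals. *)
Definition avg h k u x : R := unit_mean (fun s => u (x + (s * h) *: axis k)).

Lemma line_cts01 u x h k :
  (forall s : R, 0 <= s <= 1 -> {for x + (s * h) *: axis k, continuous u}) ->
  {within `[0, 1], continuous (fun s : R => u (x + (s * h) *: axis k))}.
Proof.
move=> cu; apply: continuous_in_subspaceT => s.
rewrite inE/= in_itv/= => /cu {}cu.
have cl : {for s, continuous (fun s : R => x + (s * h) *: axis k)}.
  apply: (@continuousD _ _ _ (cst x) (fun s : R => (s * h) *: axis k)).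
    exact: cst_continuous.
  apply: (@continuous_comp _ _ _ (fun s : R => s * h) (fun c => c *: axis k)).
    exact: mulrr_continuous.
  exact: scalel_continuous.
exact: (continuous_comp cl cu).
Qed.

Lemma ball_axis x d c k : `|c| < d -> ball x d (x + c *: axis k).
Proof.
move=> cd; apply/ball_rVP; split; first exact: le_lt_trans cd.
move=> i; rewrite !mxE eqxx/= opprD addrA subrr sub0r normrN normrM.
apply: le_lt_trans cd; rewrite -[leRHS]mulr1 ler_wpM2l//.
by case: eqP; rewrite ?normr1 ?normr0.
Qed.

Section AvgBall.
Variables (p : X) (r h : R) (k : 'I_n) (u : X -> R).
Hypothesis h0 : 0 <= h.

Let seg x s : ball p r x -> 0 <= s <= 1 -> ball p (r + h) (x + (s * h) *: axis k).
Proof. by move=> px s01; apply: (closed_cube_ball h0 px);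
  exact: closed_cube_segment. Qed.

Lemma avg_bounds a b x :
  (forall y, ball p (r + h) y -> {for y, continuous u} /\ a <= u y <= b) ->
  ball p r x -> a <= avg h k u x <= b.
Proof.
move=> ub px; apply: unit_mean_bounds.
  by apply: line_cts01 => s s01; exact: (ub _ (seg px s01)).1.
by move=> s s01; exact: (ub _ (seg px s01)).2.
Qed.

Lemma avg_continuous x :
  (forall y, ball p (r + h) y -> {for y, continuous u}) ->
  ball p r x -> {for x, continuous (avg h k u)}.
Proof.
move=> cu px; apply/continuous_ballP => e e0.
have [d d0 H] : exists2 d, 0 < d &
    forall y z, closed_cube x h y -> ball y d z -> `|u z - u y| < e / 2.
  apply: uniform_continuity; [exact: closed_cube_compact| |by rewrite divr_gt0].
  by move=> y xy; apply: cu; exact: (closed_cube_ball h0 px).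
have /nbhs_ballP[d' /= d'0 d'H] : nbhs x (ball p r).
  by apply: open_nbhs_nbhs; split => //; exact: ball_open.
exists (Num.min d d'); first by rewrite lt_min d0.
move=> y xy.
have py : ball p r y by apply: d'H; apply: le_ball xy; rewrite ge_min lexx orbT.
apply: (@le_lt_trans _ _ (e / 2)); last by rewrite gtr_pMr// invf_lt1 ?ltr1n.
apply: unit_mean_close.
- by apply: line_cts01 => s s01; exact: cu (seg py s01).
- by apply: line_cts01 => s s01; exact: cu (seg px s01).
- move=> s s01; apply/ltW/H; first exact: closed_cube_segment.
  apply: (@le_ball _ _ _ (Num.min d d')); first by rewrite ge_min lexx.
  move: xy => /ball_rVP[m0 xy]; apply/ball_rVP; split => // i.
  by have := xy i; rewrite !mxE opprD addrACA subrr addr0.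
Qed.

End AvgBall.

Section AvgC1.
Variables (p : X) (r h : R) (k : 'I_n) (u : X -> R).
Hypothesis h0 : 0 <= h.

Let seg x s : ball p r x -> 0 <= s <= 1 -> ball p (r + h) (x + (s * h) *: axis k).
Proof. by move=> px s01; apply: (closed_cube_ball h0 px);
  exact: closed_cube_segment. Qed.

Hypothesis C1u : C1_partials (ball p (r + h)) u.

Let ballnb x : ball p (r + h) x -> nbhs x (ball p (r + h)).
Proof. by move=> px; apply: open_nbhs_nbhs; split => //; exact: ball_open. Qed.

(** Differentiation under the integral sign: the partial derivative is uniformly
    continuous on the compact cube that contains the segment, so the increments are
    approximated uniformly along it. *)
Lemma is_derive_avg m x : ball p r x ->
  is_derive x (axis m) (avg h k u) (avg h k (partial m u) x).
Proof.
move=> px; have px' y : closed_cube x h y -> ball p (r + h) y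
  by exact: closed_cube_ball.
apply: is_derive_of_bound => e e0.
have [d d0 H] : exists2 d, 0 < d &
    forall y z, closed_cube x h y -> ball y d z ->
      `|partial m u z - partial m u y| < e.
  apply: uniform_continuity; [exact: closed_cube_compact| |exact: e0].
  by move=> y /px' py; exact: (C1u m py).2.
have /nbhs_ballP[d' /= d'0 d'H] : nbhs x (ball p r).
  by apply: open_nbhs_nbhs; split => //; exact: ball_open.
have cu y : ball p (r + h) y -> {for y, continuous u}.
  by move=> py; apply: (C1_continuous C1u); exact: ballnb.
exists (Num.min d d'); first by rewrite lt_min d0.
move=> t; rewrite lt_min => /andP[td td'].
have pxt : ball p r (x + t *: axis m) by apply: d'H; exact: ball_axis.
have c1 : {within `[0, 1], continuous (fun s : R =>
  u (x + t *: axis m + (s * h) *: axis k))}.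
  by apply: line_cts01 => s s01; exact: cu (seg pxt s01).
have c2 : {within `[0, 1], continuous (fun s : R => u (x + (s * h) *: axis k))}.
  by apply: line_cts01 => s s01; exact: cu (seg px s01).
have c3 : {within `[0, 1], continuous (fun s : R =>
  partial m u (x + (s * h) *: axis k))}.
  by apply: line_cts01 => s s01; exact: (C1u m (seg px s01)).2.
have c4 : {within `[0, 1], continuous (fun s : R =>
  u (x + t *: axis m + (s * h) *: axis k)
      - u (x + (s * h) *: axis k))}.
  by move=> s; apply: cvgB; [exact: c1|exact: c2].
have c5 : {within `[0, 1], continuous (fun s : R =>
  t * partial m u (x + (s * h) *: axis k))}.
  by move=> s; apply: cvgM; [exact: cvg_cst|exact: c3].
rewrite /avg -unit_meanB// -unit_meanZ//.
apply: unit_mean_close => // s s01.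
set y := x + (s * h) *: axis k.
have [a a01] : exists2 a, 0 <= a <= 1 &
    u (y + t *: axis m) - u y = partial m u (y + (a * t) *: axis m) * t.
  apply: mvt_line => a a01; apply: (C1u m _).1.
  rewrite /y addrAC; apply: seg => //; apply: d'H; apply: ball_axis.
  apply: le_lt_trans td'; rewrite normrM ler_piMl//.
  by case/andP: a01 => ? ?; rewrite ger0_norm.
rewrite addrAC -/y => ->; rewrite [t * _]mulrC -mulrBl normrM.
rewrite ler_wpM2r// ltW//; apply: H; first exact: closed_cube_segment.
apply: ball_axis; apply: le_lt_trans td; rewrite normrM ler_piMl//.
by case/andP: a01 => ? ?; rewrite ger0_norm.
Qed.

Lemma avg_C1 : C1_partials (ball p r) (avg h k u).
Proof.
move=> m x px; split; first by case: (is_derive_avg m px).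
have cm : {for x, continuous (avg h k (partial m u))}.
  by apply: (avg_continuous h0 _ px) => y py; exact: (C1u m py).2.
have nb : nbhs x (ball p r) by apply: open_nbhs_nbhs; split => //; exact: ball_open.
apply/continuous_ballP => e e0.
have /continuous_ballP/(_ e e0)[d d0 H] := cm.
have /nbhs_ballP[d' /= d'0 d'H] := nb.
exists (Num.min d d'); first by rewrite lt_min d0.
move=> y xy.
have py : ball p r y by apply: d'H; apply: le_ball xy; rewrite ge_min lexx orbT.
rewrite /partial (@derive_val _ _ _ _ _ _ _ (is_derive_avg m py)).
rewrite (@derive_val _ _ _ _ _ _ _ (is_derive_avg m px)).
by apply: H; apply: le_ball xy; rewrite ge_min lexx.
Qed.

(** This is where averaging gains a derivative: no derivative of u is left on the
    right. *)
Lemma avg_partial_self x : ball p r x ->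
  h * avg h k (partial k u) x = u (x + h *: axis k) - u x.
Proof.
move=> px; rewrite /avg -unit_meanZ; last first.
  by apply: line_cts01 => s s01; exact: (C1u k (seg px s01)).2.
apply: (etrans (@unit_mean_derivative _ (fun s => u (x + (s * h) *: axis k)) _ _ _)).
- have c3 : {within `[0, 1], continuous (fun s : R =>
  partial k u (x + (s * h) *: axis k))}.
    by apply: line_cts01 => s s01; exact: (C1u k (seg px s01)).2.
  by move=> s; apply: cvgM; [exact: cvg_cst|exact: c3].
- move=> s s01.
  have D : is_derive (s * h) 1 (fun s =>
    u (x + s *: axis k)) (partial k u (x + (s * h) *: axis k)).
    by apply: is_derive_line; exact: (C1u k (seg px s01)).1.
  have D2 : is_derive s 1 (fun s : R => s * h) h.
    by apply: is_derive_eq; rewrite scaler0 add0r [_ *: _]mulr1.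
  rewrite [h * _]mulrC.
  exact: (@is_derive1_comp R (fun s : R => u (x + s *: axis k)) (fun s => s * h)).
- by rewrite mul1r mul0r scale0r addr0.
Qed.

End AvgC1.

End Averages.

(** * The maximum principle on a half cube *)

Section SecondDerivativeTest.
Context {R : realType}.

Lemma is_derive_quadratic (a b c t : R) :
  is_derive t 1 (fun t => a + b * t + c * t ^+ 2) (b + 2 * c * t).
Proof.
pose P := a%:P + b%:P * 'X + c%:P * 'X^2.
have -> : (fun t => a + b * t + c * t ^+ 2) = horner P.
  by apply/funext => s; rewrite !hornerE.
have -> : b + 2 * c * t = P^`().[t].
  rewrite /P !(derivD, derivM, derivC, derivX, derivXn) !hornerE.
  by rewrite /=; ring.
exact: is_derive_poly.
Qed.

Lemma is_derive_half_diff (A B Q : R -> R) (a b q t : R) :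
  is_derive t 1 A a -> is_derive t 1 B b -> is_derive t 1 Q q ->
  is_derive t 1 (fun t => 2^-1 * (A t - B t) - Q t) (2^-1 * (a - b) - q).
Proof.
move=> DA DB DQ.
exact: (is_deriveB (f := 2^-1 \*: (A - B)) (is_deriveZ _ (is_deriveB DA DB)) DQ).
Qed.

(** If l > 0 then dg > 0 just after 0, and g would increase there. *)
Lemma second_derivative_max (g dg : R -> R) (d l : R) : 0 < d ->
  (forall t : R, `|t| < d -> is_derive t 1 g (dg t)) -> is_derive (0 : R) 1 dg l ->
  (forall t : R, `|t| < d -> g t <= g 0) -> l <= 0.
Proof.
move=> d0 Dg Dl gmax; rewrite leNgt; apply/negP => l0.
have in0 (t : R) : t \in `]-d, d[ -> `|t| < d by rewrite in_itv/= ltr_norml.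
have dg0 : dg 0 = 0.
  have D0 : is_derive (0 : R) 1 g 0.
    apply: (@derive1_at_max _ g (- d) d).
    - lra.
    - by move=> t /in0 /Dg[].
    - by rewrite in_itv/= oppr_lt0 d0.
    - by move=> t /in0 /gmax.
  by rewrite -(@derive_val _ _ _ _ _ _ _ (Dg 0 _)) ?normr0// derive_val.
have [e e0 dgp] : exists2 e, 0 < e & forall t, 0 < t < e -> 0 < dg t.
  have [/cvgrPdist_lt H E] := Dl.
  have /H [e /= e0 {}H] : 0 < l by [].
  exists e => // t /andP[t0 te]; have := H t;
    rewrite /ball_/= sub0r normrN gtr0_norm//.
  move=> /(_ te); rewrite gt_eqF// => /(_ isT).
  rewrite -/(derive dg 0 1) E dg0 subr0 [_%:A]mulr1 addr0 ltr_distl => /andP[_].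
  by rewrite -subr_gt0 addrK [_ *: _]mulrC pmulr_lgt0 ?invr_gt0.
have [t /andP[t0]] : exists t, 0 < t < Num.min d e.
  have m0 : 0 < Num.min d e by rewrite lt_min d0.
  by exists (Num.min d e / 2); rewrite divr_gt0//= ltr_pdivrMr// ltr_pMr// ltr1n.
rewrite lt_min => /andP[td te].
have ab (s : R) : 0 <= s <= t -> `|s| < d.
  by move=> /andP[s0 st]; rewrite ger0_norm//; lra.
have [||c] := @MVT _ g dg 0 t t0.
- by move=> s; rewrite in_itv/= => /andP[s0 st]; apply: Dg; apply: ab; lra.
- apply: derivable_within_continuous => s; rewrite in_itv/= => st.
  by have [] := Dg s (ab s st).
rewrite in_itv/= subr0 => /andP[c0 ct] E.
have : 0 < dg c * t by rewrite mulr_gt0// dgp// c0 (lt_trans ct).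
rewrite -E subr_gt0 ltNge gmax//; apply: ab; lra.
Qed.

End SecondDerivativeTest.

Lemma continuous_at_sum {R : numFieldType} {T : topologicalType} (I : Type)
    (s : seq I) (F : I -> T -> R) (x : T) :
  (forall i, {for x, continuous (F i)}) ->
  {for x, continuous (fun y => \sum_(i <- s) F i y)}.
Proof.
move=> cF; have C : \sum_(i <- s) F i y @[y --> nbhs x] --> \sum_(i <- s) F i x.
  elim: s => [|i s IH].
    by under eq_fun do rewrite big_nil; rewrite big_nil; exact: cvg_cst.
  under eq_fun do rewrite big_cons; rewrite big_cons.
  by apply: cvgD => //; exact: cF.
exact: C.
Qed.

Section HarmonicEstimate.
Context {R : realType} {n : nat}.
Local Notation X := 'rV[R]_n.
Implicit Types (u : X -> R) (x y z p : X) (k m : 'I_n) (d r : R).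

(** The functions to which the maximum principle below applies: it looks at pure
    second derivatives only. *)
Definition harmonic_on (W : set X) u :=
  (forall x, W x -> {for x, continuous u}) /\
  (forall m x, W x -> derivable u x (axis m) /\ derivable (partial m u) x (axis m)) /\
  forall x, W x -> \sum_m partial m (partial m u) x = 0.

(** The reflection in the hyperplane through p orthogonal to the axis k. *)
Definition mirror p k x : X := x - (2 * (x 0 k - p 0 k)) *: axis k.

Lemma mirrorE p k x i :
  mirror p k x 0 i - p 0 i = (if i == k then -1 else 1) * (x 0 i - p 0 i).
Proof.
rewrite !mxE eqxx/=; case: (eqVneq i k) => [->|ik].
  by rewrite mulr1; ring.
by rewrite mulr0 subr0 mul1r.
Qed.

Lemma mirror_norm p k x i : `|mirror p k x 0 i - p 0 i| = `|x 0 i - p 0 i|.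
Proof. by rewrite mirrorE; case: eqP; rewrite ?mul1r// mulN1r normrN. Qed.

Lemma mirror_ball p k x r : ball p r x -> ball p r (mirror p k x).
Proof.
move=> /ball_rVP[r0 px]; apply/ball_rVP; split => // i.
by rewrite distrC mirror_norm distrC.
Qed.

Lemma mirror_line p k x m (t : R) : mirror p k (x + t *: axis m) =
  mirror p k x + ((if m == k then -1 else 1) * t) *: axis m.
Proof.
apply/rowP => i; rewrite !mxE !eqxx/=.
case: (eqVneq m k) => [->|mk]; first by case: (i == k); rewrite /=; ring.
by case: (i == k); case: (i == m); rewrite /=; ring.
Qed.

Lemma is_derive_mirror u p k m x t :
  derivable u (mirror p k (x + t *: axis m)) (axis m) ->
  is_derive t 1 (fun t => u (mirror p k (x + t *: axis m)))
    ((if m == k then -1 else 1) * partial m u (mirror p k (x + t *: axis m))).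
Proof.
rewrite (_ : (fun t => u (mirror p k (x + t *: axis m))) = (fun t =>
    u (mirror p k x + ((if m == k then -1 else 1) * t) *: axis m))); last first.
  by apply/funext => q; rewrite mirror_line.
rewrite mirror_line; set c : R := if _ then _ else _ => /is_derive_line D.
have D2 : is_derive t 1 (fun t : R => c * t) c.
  have := is_derive_quadratic 0 c 0 t; rewrite mulr0 mul0r addr0.
  congr (is_derive _ _ _ _); apply/funext => q; ring.
rewrite [c * _]mulrC.
exact: (@is_derive1_comp R (fun s : R => u (mirror p k x + s *: axis m)) (fun s =>
  c * s)).
Qed.

Lemma mirror_continuous p k : continuous (mirror p k).
Proof.
move=> x; apply: (@continuousB _ _ _ id); first by [].
apply: (@continuous_comp _ _ _ (fun x => 2 * (x 0 k - p 0 k)) (fun c => c *: axis k)).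
  apply: (@continuousM _ _ (cst 2)); first exact: cst_continuous.
  apply: (@continuousB _ _ _ (fun x => x 0 k)); last exact: cst_continuous.
  exact: coord_continuous.
exact: scalel_continuous.
Qed.

(** Write y = x - p. On the half cube where 0 <= y_k and all |y_i| <= d, the odd
    part (u x - u (mirror x)) / 2 vanishes on the face y_k = 0 and is at most M. The
    barrier M / d^2 * (sum_i y_i^2 + (n + 1) y_k (d - y_k)) is nonnegative on that
    face, at least M on the others, and has a negative Laplacian, so the odd part
    minus the barrier has no interior maximum and is nonpositive. On the axis through
    p the barrier is at most (n + 1) M t / d. *)
Lemma harmonic_odd_bound u p k d r M : 0 < d < r -> 0 < M ->
  harmonic_on (ball p r) u -> (forall x, ball p r x -> `|u x| <= M) ->
  forall t, 0 <= t <= d ->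
  u (p + t *: axis k) - u (p - t *: axis k) <= 2 * (n.+1%:R * M / d) * t.
Proof.
move=> /andP[d0 dr] M0 [cu [du lap]] uM t /andP[t0 td].
pose c := M / d ^+ 2.
have c0 : 0 < c by rewrite divr_gt0// exprn_gt0.
have cd : c * d ^+ 2 = M by rewrite divfK// expf_neq0// gt_eqF.
pose y (x : X) i := x 0 i - p 0 i.
pose v x := c * (\sum_i y x i ^+ 2 + n.+1%:R * (y x k * (d - y x k))).
pose w x := 2^-1 * (u x - u (mirror p k x)) - v x.
pose K : set X := [set x | (forall i, `|y x i| <= d) /\ 0 <= y x k].
have Kball x : K x -> ball p r x.
  move=> [H _]; apply/ball_rVP; split; first exact: lt_trans dr.
  by move=> i; rewrite distrC (le_lt_trans (H i)).
have cK : compact K.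
  have := @rV_compact R n (fun i =>
    `[(if i == k then p 0 i else p 0 i - d), p 0 i + d]%classic)
   (fun i => @segment_compact _ _ _).
  congr compact; apply/seteqP; split => x.
    move=> H; split => [i|].
      have := H i; rewrite /= in_itv/= ler_distl.
      by case: ifP => // _ /andP[? ?]; apply/andP; split => //; lra.
    by have := H k; rewrite /= in_itv/= eqxx => /andP[? ?]; rewrite subr_ge0.
  move=> [H1 H2] i; rewrite /= in_itv/=; have := H1 i;
    rewrite ler_distl => /andP[? ->].
  by case: eqP => [->|_]; rewrite andbT// -subr_ge0.
have cw : {within K, continuous w}.
  apply: continuous_in_subspaceT => x; rewrite inE => /Kball px.
  have cy i : {for x, continuous (y ^~ i)}.
    apply: (@continuousB _ _ _ (fun x => x 0 i)); last exact: cst_continuous.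
    exact: coord_continuous.
  have cs : {for x, continuous (fun x => u (mirror p k x))}.
    have := @continuous_comp _ _ _ (mirror p k) u x (@mirror_continuous p k x).
    by apply; apply: cu; exact: mirror_ball.
  have cc (a : R) : {for x, continuous (fun=> a : R)} by exact: cst_continuous.
  have cv : {for x, continuous v}.
    have cS : {for x, continuous (fun x => \sum_i y x i ^+ 2)}.
      apply: (@continuous_at_sum _ _ _ _ (fun i x => y x i ^+ 2)) => i.
      exact: (continuous_comp (cy i) (@exprn_continuous _ 2 _)).
    have cQ : {for x, continuous (fun x => n.+1%:R * (y x k * (d - y x k)))}.
      apply: (continuousM (cc _)); apply: (continuousM (cy k)).
      exact: (continuousB (cc d) (cy k)).
    exact: (continuousM (cc c) (continuousD cS cQ)).
  have cux : {for x, continuous u} by exact: cu.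
  apply: (@continuousB _ _ _ (fun x => 2^-1 * (u x - u (mirror p k x))) v) => //.
  exact: (continuousM (cc _) (continuousB cux cs)).
have K0 : K !=set0.
  by exists p; split => [i|]; rewrite /y subrr ?normr0// ltW.
have [x0 + xmax] := EVT_max_rV K0 cK cw; rewrite inE => Kx0.
have sq0 x : 0 <= \sum_i y x i ^+ 2 by apply: sumr_ge0 => i _; rewrite sqr_ge0.
have bnd x : K x -> 0 <= y x k * (d - y x k).
  move=> [H1 H2]; rewrite mulr_ge0// subr_ge0.
  by rewrite (le_trans _ (H1 k))// ler_norm.
(* On the boundary the barrier dominates; at an interior maximum the second
   derivatives along the axes, whose sum is 2 c, could not all be nonpositive. *)
have wle : w x0 <= 0.
  clear t t0 td.
  have px0 := Kball _ Kx0.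
  have upsi : 2^-1 * (u x0 - u (mirror p k x0)) <= M.
    have /ler_normlP[_ h1] := uM _ px0.
    have /ler_normlP[h2 _] := uM _ (mirror_ball k px0).
    lra.
  have [yk0|yk0] := eqVneq (y x0 k) 0.
    have -> : w x0 = - v x0.
      rewrite /w (_ : mirror p k x0 = x0) ?subrr ?mulr0 ?sub0r//.
      by rewrite /mirror -/(y x0 k) yk0 mulr0 scale0r subr0.
    by rewrite oppr_le0 mulr_ge0 ?(ltW c0)// addr_ge0// mulr_ge0// bnd.
  have [[i yi]|int] := pselect (exists i, `|y x0 i| = d).
    rewrite subr_le0 (le_trans upsi)// -cd ler_wpM2l ?(ltW c0)//.
    rewrite -[leLHS]addr0 lerD//; last by rewrite mulr_ge0// bnd.
    rewrite (bigD1 i)//= -yi real_normK ?num_real// lerDl.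
    by apply: sumr_ge0 => j _; rewrite sqr_ge0.
  have {}int i : `|y x0 i| < d.
    by rewrite lt_neqAle Kx0.1 andbT; apply/eqP => E; apply: int; exists i.
  have {}yk0 : 0 < y x0 k by rewrite lt_neqAle eq_sym yk0 Kx0.2.
  pose l m := 2^-1 * (partial m (partial m u) x0
    - partial m (partial m u) (mirror p k x0))
              - c * (2 - (if m == k then 2 * n.+1%:R else 0)).
  have l0 m : l m <= 0.
    pose s : R := if m == k then -1 else 1.
    pose b : R := if m == k then n.+1%:R else 0.
    have yE t i : y (x0 + t *: axis m) i = y x0 i + (if i == m then t else 0).
      rewrite /y !mxE eqxx/=; case: (i == m); rewrite /=; ring.
    have vE t : v (x0 + t *: axis m) = c * (\sum_i y x0 i ^+ 2 +
        (2 * y x0 m * t + t ^+ 2)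
        + (n.+1%:R * (y x0 k * (d - y x0 k)) + b * t * (d - 2 * y x0 k - t))).
      rewrite /v; congr (c * (_ + _)).
        rewrite (bigD1 m)//= [in RHS](bigD1 m)//= yE eqxx.
        rewrite (eq_bigr (fun i => y x0 i ^+ 2)); first by ring.
        by move=> i im; rewrite yE (negbTE im) addr0.
      rewrite yE /b eq_sym; case: ifP => _; ring.
    pose e := Num.min (d - `|y x0 m|) (y x0 k).
    have e0 : 0 < e by rewrite lt_min yk0 subr_gt0 int.
    have Ke (t : R) : `|t| < e -> K (x0 + t *: axis m).
      rewrite lt_min => /andP[t1 t2]; split => [i|]; rewrite yE.
        case: eqP => [->|_]; last by rewrite addr0 Kx0.1.
        by apply: (le_trans (ler_normD _ _)); lra.
      have := ltr_norml t (y x0 k); rewrite t2 => /esym/andP[h _].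
      by case: ifP => _; lra.
    pose dg (t : R) := 2^-1 * (partial m u (x0 + t *: axis m) -
        s * partial m u (mirror p k (x0 + t *: axis m)))
        - c * (2 * y x0 m + 2 * t + b * (d - 2 * y x0 k - 2 * t)).
    apply: (@second_derivative_max _ (fun t => w (x0 + t *: axis m)) dg e (l m) e0).
    - move=> t /Ke Kt.
      have pt := Kball _ Kt.
      have D1 := is_derive_line (du m _ pt).1.
      have D2 := is_derive_mirror (du m _ (mirror_ball k pt)).1.
      rewrite /w.
      have D3 : is_derive t 1 (fun t : R => v (x0 + t *: axis m))
          (c * (2 * y x0 m + 2 * t + b * (d - 2 * y x0 k - 2 * t))).
        have := is_derive_quadratic (c * (\sum_i y x0 i ^+ 2 +
          n.+1%:R * (y x0 k * (d - y x0 k)))) (c * (2 * y x0 m +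
            b * (d - 2 * y x0 k)))
          (c * (1 - b)) t.
        congr (is_derive _ _ _ _); last by ring.
        by apply/funext => q; rewrite vE; ring.
      exact: is_derive_half_diff D1 D2 D3.
    - have px0' : ball p r (x0 + 0 *: axis m) by rewrite scale0r addr0.
      have D1 := is_derive_line (du m _ px0').2.
      have D2 := is_derive_mirror (du m _ (mirror_ball k px0')).2.
      have D4 : is_derive (0 : R) 1 (fun t =>
        s * partial m u (mirror p k (x0 + t *: axis m)))
         (partial m (partial m u) (mirror p k x0)).
        have := is_deriveZ s D2; rewrite scale0r addr0 -/s.
        set Z := partial m (partial m u) _; suff -> : s *: (s * Z) = Z by [].
        by rewrite -[LHS]/(s * (s * Z)) mulrA /s; case: ifP => _;
          rewrite ?mulrNN !mul1r.
      have D5 : is_derive (0 : R) 1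
          (fun t => c * (2 * y x0 m + 2 * t + b * (d - 2 * y x0 k - 2 * t)))
          (c * (2 - 2 * b)).
        have := is_derive_quadratic (c * (2 * y x0 m + b * (d - 2 * y x0 k)))
          (c * (2 - 2 * b)) 0 0.
        congr (is_derive _ _ _ _); last by ring.
        by apply/funext => q; ring.
      have := is_derive_half_diff D1 D4 D5.
      rewrite scale0r addr0 (_ : 2 * b = if m == k then 2 * n.+1%:R else 0)//.
      by rewrite /b; case: ifP => _; rewrite ?mulr0.
    - move=> t /Ke Kt; rewrite scale0r addr0; apply: xmax; exact/mem_set.
  have : \sum_m l m <= 0 by apply: sumr_le0 => m _; exact: l0.
  have -> : \sum_m l m = 2^-1 * (\sum_m partial m (partial m u) x0 -
      \sum_m partial m (partial m u) (mirror p k x0)) -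
      c * (\sum_(m < n) 2 - \sum_m (if m == k then 2 * n.+1%:R else 0)).
    by rewrite -!sumrB !mulr_sumr -sumrB.
  have drop (A B C : R) : A = 0 -> B = 0 -> 2^-1 * (A - B) - C = - C.
    by move=> -> ->; rewrite subrr mulr0 sub0r.
  rewrite (drop _ _ _ (lap _ px0) (lap _ (mirror_ball k px0))) -big_mkcond/=
    big_pred1_eq sumr_const card_ord.
  rewrite oppr_le0 pmulr_rge0// -mulr_natr -natr1; lra.
have : w (p + t *: axis k) <= 0.
  apply: le_trans wle; apply: xmax; apply/mem_set.
  split => [i|]; rewrite /y !mxE eqxx/= addrAC subrr add0r;
    last by rewrite eqxx mulr1.
  by case: eqP => _; rewrite ?mulr1 ?mulr0 ?normr0 ?ger0_norm//; lra.
rewrite /w subr_le0.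
have yt i : y (p + t *: axis k) i = if i == k then t else 0.
  by rewrite /y !mxE eqxx/= addrAC subrr add0r; case: eqP; rewrite ?mulr1 ?mulr0.
have -> : mirror p k (p + t *: axis k) = p - t *: axis k.
  rewrite mirror_line eqxx mulN1r scaleNr; congr (_ - _).
  by rewrite /mirror subrr mulr0 scale0r subr0.
have -> : v (p + t *: axis k) = c * (t ^+ 2 + n.+1%:R * (t * (d - t))).
  rewrite /v yt eqxx; congr (c * (_ + _)).
  rewrite (bigD1 k)//= yt eqxx big1 ?addr0// => i ik.
  by rewrite yt (negbTE ik) expr0n.
move=> H.
have {H} : u (p + t *: axis k) - u (p - t *: axis k) <=
    2 * (c * (t ^+ 2 + n.+1%:R * (t * (d - t)))) by lra.
move=> /le_trans; apply.
rewrite -mulrA ler_pM2l//.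
have -> : n.+1%:R * M / d * t = c * (n.+1%:R * (t * d)).
  by rewrite /c expr2 invfM; field; rewrite gt_eqF.
rewrite ler_pM2l// -natr1; have : 0 <= (n%:R : R) by []; nra.
Qed.

End HarmonicEstimate.

(** * Calculus of continuously differentiable functions *)

Section C1Calculus.
Context {R : realType} {n : nat}.
Local Notation X := 'rV[R]_n.
Implicit Types (u v : X -> R) (x y z p : X) (k l m : 'I_n) (W : set X).

Lemma open_nbhs_in W x : open W -> W x -> nbhs x W.
Proof. by move=> oW Wx; apply: open_nbhs_nbhs. Qed.

Lemma open_ball_in W x : open W -> W x -> exists2 d, 0 < d & ball x d `<=` W.
Proof. by move=> oW /(open_nbhs_in oW)/nbhs_ballP[d /= d0 H]; exists d. Qed.

Lemma continuous_at_eq W u v x : open W -> W x -> (forall y, W y -> u y = v y) ->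
  {for x, continuous u} -> {for x, continuous v}.
Proof.
move=> oW Wx uv /continuous_ballP cu; apply/continuous_ballP => e /cu[d d0 H].
have [d' d'0 H'] := open_ball_in oW Wx.
exists (Num.min d d'); first by rewrite lt_min d0.
move=> y xy; rewrite -!uv//; last by apply: H'; apply: le_ball xy;
  rewrite ge_min lexx orbT.
by apply: H; apply: le_ball xy; rewrite ge_min lexx.
Qed.

Lemma is_derive_eq_on W u v x z d : open W -> W x -> (forall y, W y -> u y = v y) ->
  is_derive x z u d -> is_derive x z v d.
Proof.
move=> oW Wx uv; have [->|z0] := eqVneq z 0.
  move=> [_ <-]; rewrite derive0; exact: is_derive0.
by apply: near_eq_is_derive => //; apply: filterS (open_nbhs_in oW Wx) => y Wy;
  rewrite uv.
Qed.

Lemma partial_eq_on W u v k x : open W -> W x -> (forall y, W y -> u y = v y) ->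
  derivable u x (axis k) -> partial k u x = partial k v x.
Proof.
move=> oW Wx uv /derivableP/(is_derive_eq_on oW Wx uv) D.
by rewrite /partial derive_val.
Qed.

Lemma C1_eq_on W u v : open W -> (forall y, W y -> u y = v y) ->
  C1_partials W u -> C1_partials W v.
Proof.
move=> oW uv C1 k x Wx; have [du cu] := C1 k x Wx.
split; first by have [] := is_derive_eq_on oW Wx uv (derivableP du).
apply: (continuous_at_eq oW Wx _ cu) => y Wy.
exact: (partial_eq_on oW Wy uv (C1 k y Wy).1).
Qed.

Lemma C1_subset W W' u : W `<=` W' -> C1_partials W' u -> C1_partials W u.
Proof. by move=> WW C1 k x /WW; exact: C1. Qed.

Lemma is_derive_lincomb (a b : R) u v x z (du dv : R) :
  is_derive x z u du -> is_derive x z v dv ->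
  is_derive x z (fun y => a * u y + b * v y) (a * du + b * dv).
Proof.
move=> Du Dv; exact: (is_deriveD (f := a \*: u) (g := b \*: v)).
Qed.

Lemma C1_lincomb W (a b : R) u v : open W -> C1_partials W u -> C1_partials W v ->
  C1_partials W (fun y => a * u y + b * v y).
Proof.
move=> oW Cu Cv k x Wx.
have D y (Wy : W y) := is_derive_lincomb a b (derivableP (Cu k y Wy).1) (derivableP
  (Cv k y Wy).1).
split; first by have [] := D x Wx.
apply: (@continuous_at_eq W (fun y =>
  a * partial k u y + b * partial k v y) _ x oW Wx).
  by move=> y Wy; rewrite /partial (@derive_val _ _ _ _ _ _ _ (D y Wy)).
have cc (c : R) : {for x, continuous (fun=> c : R)} by exact: cst_continuous.
exact: (continuousD (continuousM (cc a) (Cu k x Wx).2) (continuousM (cc b) (Cv k x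
  Wx).2)).
Qed.

Lemma is_derive_translate u x z c d : is_derive (x + c) z u d ->
  is_derive x z (fun y => u (y + c)) d.
Proof.
have E : (fun h : R => h^-1 *: (((fun y =>
  u (y + c)) \o shift x) (h *: z) - u (x + c))) =
         (fun h => h^-1 *: ((u \o shift (x + c)) (h *: z) - u (x + c))).
  by apply/funext => h /=; rewrite addrA.
by move=> [du <-]; apply: DeriveDef; rewrite /derivable /derive E.
Qed.

Lemma partial_translate u k c x :
  partial k (fun y => u (y + c)) x = partial k u (x + c).
Proof.
have E : (fun h : R => h^-1 *: (((fun y =>
  u (y + c)) \o shift x) (h *: axis k) - u (x + c))) =
         (fun h => h^-1 *: ((u \o shift (x + c)) (h *: axis k) - u (x + c))).
  by apply/funext => h /=; rewrite addrA.
by rewrite /partial /derive E.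
Qed.

Lemma C1_translate W W' u c : (forall x, W x -> W' (x + c)) ->
  C1_partials W' u -> C1_partials W (fun y => u (y + c)).
Proof.
move=> WW C1 k x /WW /(C1 k)[du cu]; split.
  by have [] := is_derive_translate (derivableP du).
rewrite (_ : partial k _ = fun y => partial k u (y + c)).
  have ct : {for x, continuous (fun y => y + c)}.
    have ci : {for x, continuous (@id X)} by [].
    have cc : {for x, continuous (fun=> c : X)} by exact: cst_continuous.
    exact: (continuousD ci cc).
  exact: (continuous_comp ct cu).
by apply/funext => y; rewrite partial_translate.
Qed.

(** The mean value theorem, used in the direction k and then in the direction l. *)
Lemma second_difference W u x k l t : (forall i, C1_partials W (partial i u)) ->
  C1_partials W u -> 0 < t -> ball x (4 * t) `<=` W ->
  exists2 z, ball x (4 * t) z &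
    u (x + t *: axis k + t *: axis l) - u (x + t *: axis k) -
      (u (x + t *: axis l) - u x) = t * t * partial l (partial k u) z.
Proof.
move=> C2 C1 t0 HW.
have bx (a b : R) : 0 <= a <= 1 -> 0 <= b <= 1 ->
    ball x (4 * t) (x + (a * t) *: axis k + (b * t) *: axis l).
  have H (c : R) : 0 <= c <= 1 -> `|c * t| < 2 * t.
    by move=> /andP[c0 c1]; rewrite ger0_norm ?mulr_ge0// ?(ltW t0)//; nra.
  move=> a01 b01; rewrite (_ : 4 * t = 2 * t + 2 * t); last by ring.
  by apply: ball_triangle (ball_axis _ _ (H a a01)) (ball_axis _ _ (H b b01)).
have i0 : 0 <= (0 : R) <= 1 by apply/andP; split; lra.
have i1 : 0 <= (1 : R) <= 1 by apply/andP; split; lra.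
pose v y := 1 * u (y + t *: axis l) + (-1) * u y.
have Dv a : 0 <= a <= 1 -> is_derive (x + (a * t) *: axis k) (axis k) v
    (1 * partial k u (x + (a * t) *: axis k + t *: axis l) + (-1) * partial k u (x +
      (a * t) *: axis k)).
  move=> a01; apply: is_derive_lincomb.
    apply: is_derive_translate; apply/derivableP.
    by have := bx a 1 a01 i1; rewrite mul1r => /HW /(C1 k)[].
  apply/derivableP.
  by have := bx a 0 a01 i0; rewrite mul0r scale0r addr0 => /HW /(C1 k)[].
have [a a01] : exists2 a, 0 <= a <= 1 & v (x + t *: axis k) - v x =
    'D_(axis k) v (x + (a * t) *: axis k) * t.
  by apply: mvt_line => a /Dv[].
rewrite (@derive_val _ _ _ _ _ _ _ (Dv a a01)) => E.
have [b b01] : exists2 b, 0 <= b <= 1 &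
    partial k u (x + (a * t) *: axis k + t *: axis l) - partial k u (x +
      (a * t) *: axis k) =
    partial l (partial k u) (x + (a * t) *: axis k + (b * t) *: axis l) * t.
  by apply: mvt_line => b b01; have /HW/(C2 k l)[] := bx a b a01 b01.
rewrite mul1r mulN1r in E => E2; rewrite E2 in E.
exists (x + (a * t) *: axis k + (b * t) *: axis l); first exact: bx.
rewrite -mulrA [t * (t * _)]mulrC [t * _]mulrC -E /v; ring.
Qed.

Lemma ler_dist_common (A B C D e : R) :
  A = B -> `|A - C| < e / 2 -> `|B - D| < e / 2 -> `|C - D| <= e.
Proof.
move=> -> h1 h2; rewrite (_ : C - D = (B - D) - (B - C)); last by ring.
have := ler_normB (B - D) (B - C); lra.
Qed.

(** Both mixed derivatives are limits of the same second difference. *)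
Lemma schwarz W u k l x : open W -> C1_partials W u ->
  (forall i, C1_partials W (partial i u)) -> W x ->
  partial l (partial k u) x = partial k (partial l u) x.
Proof.
move=> oW C1 C2 Wx; apply/eqP; rewrite -subr_eq0 -normr_le0.
apply/ler_addgt0Pr => e e0; rewrite add0r.
have [d d0 H] := open_ball_in oW Wx.
have e2 : 0 < e / 2 by rewrite divr_gt0.
have /continuous_ballP/(_ _ e2)[d1 d10 H1] := (C2 k l x Wx).2.
have /continuous_ballP/(_ _ e2)[d2 d20 H2] := (C2 l k x Wx).2.
pose m := Num.min d (Num.min d1 d2); have m0 : 0 < m by rewrite !lt_min d0 d10.
pose t := m / 4; have t0 : 0 < t by rewrite divr_gt0.
have mE : 4 * t = m by rewrite mulrC divfK.
have bm y : ball x (4 * t) y -> [/\ W y, ball x d1 y & ball x d2 y].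
  rewrite mE => xy; split; [apply: H|..]; apply: le_ball xy;
    rewrite /m !ge_min lexx ?orbT//.
have HW : ball x (4 * t) `<=` W by move=> y /bm[].
have [z /bm[_ z1 _] E1] := second_difference k l C2 C1 t0 HW.
have [z' /bm[_ _ z2] E2] := second_difference l k C2 C1 t0 HW.
have swap (A B C D T : R) : A - B - (C - D) = T -> A - C - (B - D) = T by move=> <-;
  ring.
rewrite (addrAC x) in E2; move/swap: E2 => E2.
have tt : t * t != 0 by rewrite mulf_neq0// gt_eqF.
have Ez := mulfI tt (etrans (esym E1) E2).
exact: (ler_dist_common Ez (H1 _ z1) (H2 _ z2)).
Qed.

End C1Calculus.

(** * First-order systems and iterated averages *)

Section IteratedAverages.
Context {R : realType} {n : nat}.
Local Notation X := 'rV[R]_n.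
Implicit Types (u : X -> R) (x y z p : X) (k m : 'I_n) (h r : R).

Definition avgs h (ks : seq 'I_n) u : X -> R := foldr (avg h) u ks.

Let radiusS r h (ks : seq 'I_n) :
  r + (size ks).+1%:R * h = r + h + (size ks)%:R * h.
Proof. by rewrite -natr1; ring. Qed.

Lemma avgs_bounds p r h ks u a b x : 0 <= h ->
  C1_partials (ball p (r + (size ks)%:R * h)) u ->
  (forall y, ball p (r + (size ks)%:R * h) y -> a <= u y <= b) ->
  ball p r x -> C1_partials (ball p r) (avgs h ks u) /\ a <= avgs h ks u x <= b.
Proof.
move=> h0; elim: ks r x => [|k ks IH] r x /=.
  by rewrite mul0r addr0 => C1 H px; split => //; exact: H.
rewrite radiusS => C1 H px.
have IH' y : ball p (r + h) y -> C1_partials (ball p (r + h)) (avgs h ks u) /\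
  a <= avgs h ks u y <= b by exact: IH.
have px' : ball p (r + h) x by apply: le_ball px; rewrite lerDl.
have C := (IH' x px').1.
split; first exact: avg_C1.
apply: (avg_bounds (r := r) (p := p)) => // y py.
split; last exact: (IH' y py).2.
by apply: (C1_continuous C); apply: open_nbhs_in => //; exact: ball_open.
Qed.

Lemma avgs_C1 p r h ks u : 0 <= h ->
  C1_partials (ball p (r + (size ks)%:R * h)) u ->
    C1_partials (ball p r) (avgs h ks u).
Proof.
move=> h0; elim: ks r => [|k ks IH] r /=; first by rewrite mul0r addr0.
rewrite radiusS => /IH; exact: avg_C1.
Qed.

(** Induction on ks: the derivative in the direction of the outermost average is a
    difference quotient of the inner ones, and the other derivatives commute with
    that average. *)
Lemma avgs_C2 p r h ks u k : 0 < h ->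
  C1_partials (ball p (r + (size ks)%:R * h)) u -> k \in ks ->
  C1_partials (ball p r) (partial k (avgs h ks u)).
Proof.
move=> h0; elim: ks r => [|j ks IH] r //=; rewrite radiusS inE => C1 kj.
have C := avgs_C1 (ltW h0) C1.
have oB s : open (ball p s) by exact: ball_open.
have [kE|kNj] := eqVneq k j; last first.
  rewrite (negbTE kNj) /= in kj.
  apply: (@C1_eq_on _ _ _ (avg h j (partial k (avgs h ks u)))) => //.
    move=> y py; rewrite /partial.
    by rewrite (@derive_val _ _ _ _ _ _ _ (is_derive_avg j (ltW h0) C k py)).
  by apply: avg_C1; [exact: ltW|exact: IH].
rewrite kE.
pose w := avgs h ks u.
apply: (@C1_eq_on _ _ _ (fun y => h^-1 * w (y + h *: axis j) + (- h^-1) * w y)) => //.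
  move=> y py; rewrite /partial.
  rewrite (@derive_val _ _ _ _ _ _ _ (is_derive_avg j (ltW h0) C j py)).
  rewrite mulNr -mulrBr -(avg_partial_self j (ltW h0) C py) mulKf// gt_eqF//.
apply: C1_lincomb => //.
  apply: (C1_translate _ C) => y py.
  apply: (closed_cube_ball (ltW h0) py); rewrite -[h in h *: _]mul1r.
  by apply: closed_cube_segment; [exact: ltW|apply/andP; split; lra].
by apply: (C1_subset _ C) => y; apply: le_ball; rewrite lerDl ltW.
Qed.

Lemma avgs_close u x W ks : open W -> W x -> C1_partials W u ->
  forall e, 0 < e -> exists2 h0, 0 < h0 &
    forall h, 0 < h < h0 -> `|avgs h ks u x - u x| <= e.
Proof.
move=> oW Wx C1 e e0; have [d d0 dW] := open_ball_in oW Wx.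
have cu := C1_continuous C1 (open_nbhs_in oW Wx).
have /continuous_ballP/(_ e e0)[d' d'0 H] := cu.
pose m := Num.min d d'; have m0 : 0 < m by rewrite lt_min d0.
pose s := (size ks).+1%:R : R; have s0 : 0 < s by [].
exists (m / 2 / s); first by rewrite !divr_gt0.
move=> h /andP[h0 hm].
have rm : m / 2 + (size ks)%:R * h <= m.
  have : s * h <= m / 2 by rewrite mulrC -ler_pdivlMr// ltW.
  rewrite /s -natr1 => ?; lra.
have sub y : ball x (m / 2 + (size ks)%:R * h) y -> W y /\ ball x d' y.
  move=> /(le_ball rm) xy; split; first by apply: dW; apply: le_ball xy;
    rewrite ge_min lexx.
  by apply: le_ball xy; rewrite ge_min lexx orbT.
have [|y /sub[_ /H]||_] := @avgs_bounds x (m / 2) h ks u (u x - e) (u x +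
  e) x (ltW h0).
- by apply: (C1_subset _ C1) => y /sub[].
- by rewrite ltr_distl => /andP[? ?]; rewrite !ltW.
- by apply: ballxx; rewrite divr_gt0.
- by rewrite ler_distl.
Qed.

End IteratedAverages.

Section DiracSystem.
Context {R : realType} {n N : nat}.
Local Notation X := 'rV[R]_n.
Implicit Types (x y z p : X) (k l m : 'I_n) (c : 'I_N) (h r : R) (W : set X).
Variable a : 'I_n -> 'M[R]_N.
Implicit Types F G : 'I_N -> X -> R.

(** The matrices a k will be left multiplications by quaternion units: the system is
    then of Dirac type. *)
Definition dirac F x c : R :=
  \sum_k \sum_c' a k c c' * partial k (F c') x.

Definition dirac_solution W F :=
  (forall c, C1_partials W (F c)) /\ forall x c, W x -> dirac F x c = 0.

Lemma dirac_solution_subset W W' F : W `<=` W' -> dirac_solution W' F ->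
  dirac_solution W F.
Proof.
by move=> WW [C1 e]; split => [c|x c /WW]; [exact: C1_subset (C1 c)|exact: e].
Qed.

Lemma dirac_solution_lincomb W (s t : R) F G : open W ->
  dirac_solution W F -> dirac_solution W G ->
  dirac_solution W (fun c x => s * F c x + t * G c x).
Proof.
move=> oW [C1F eF] [C1G eG]; split => [c|x c Wx]; first exact: C1_lincomb.
have E c' k : partial k (fun x => s * F c' x + t * G c' x) x =
    s * partial k (F c') x + t * partial k (G c') x.
  rewrite /partial; apply: derive_val; apply: is_derive_lincomb; apply/derivableP.
    exact: (C1F c' k x Wx).1.
  exact: (C1G c' k x Wx).1.
transitivity (s * dirac F x c + t * dirac G x c);
  last by rewrite eF// eG// !mulr0 addr0.
rewrite /dirac !mulr_sumr -big_split/=; apply: eq_bigr => k _.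
rewrite !mulr_sumr -big_split/=; apply: eq_bigr => c' _.
by rewrite E; ring.
Qed.

Lemma dirac_solution_translate W W' F v : (forall x, W x -> W' (x + v)) ->
  dirac_solution W' F -> dirac_solution W (fun c x => F c (x + v)).
Proof.
move=> WW [C1 e]; split => [c|x c Wx]; first exact: (C1_translate WW).
rewrite -[RHS](e (x + v) c (WW x Wx)); apply: eq_bigr => k _; apply: eq_bigr => c' _.
by rewrite partial_translate.
Qed.

Lemma unit_mean_sum (I : Type) (s : seq I) (w : I -> R) (f : I -> R -> R) :
  (forall i, {within `[0, 1], continuous (f i)}) ->
  {within `[0, 1], continuous (fun t => \sum_(i <- s) w i * f i t)} /\
  unit_mean (fun t => \sum_(i <- s) w i * f i t) = \sum_(i <- s) w i * unit_mean (f
    i).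
Proof.
move=> cf; elim: s => [|i s [IH1 IH2]].
  rewrite (_ : (fun t => _) = fun=> 0); last by apply/funext => t; rewrite big_nil.
  by rewrite unit_mean_cst big_nil; split => // ?; exact: cvg_cst.
have c1 : {within `[0, 1], continuous (fun t => w i * f i t)}.
  by move=> t; apply: cvgM; [exact: cvg_cst|exact: cf].
rewrite (_ : (fun t => _) = fun t => w i * f i t + \sum_(j <- s) w j * f j t);
  last first.
  by apply/funext => t; rewrite big_cons.
split; first by move=> t; apply: cvgD; [exact: c1|exact: IH1].
by rewrite unit_meanD// unit_meanZ// IH2 big_cons.
Qed.

(** The coefficients are constant, so the system commutes with averaging. *)
Lemma avg_dirac_solution p r h k F : 0 <= h ->
  dirac_solution (ball p (r + h)) F ->
  dirac_solution (ball p r) (fun c => avg h k (F c)).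
Proof.
move=> h0 [C1 e]; split => [c|x c px]; first exact: avg_C1.
have seg (s : R) : 0 <= s <= 1 -> ball p (r + h) (x + (s * h) *: axis k).
  by move=> s01; apply: (closed_cube_ball h0 px); exact: closed_cube_segment.
have E c' l : partial l (avg h k (F c')) x = avg h k (partial l (F c')) x.
  by rewrite /partial (@derive_val _ _ _ _ _ _ _ (is_derive_avg k h0 (C1 c') l px)).
rewrite /dirac; under eq_bigr do under eq_bigr do rewrite E.
have cf (kc : 'I_n * 'I_N) :
    {within `[0, 1], continuous (fun s : R =>
      partial kc.1 (F kc.2) (x + (s * h) *: axis k))}.
  by apply: line_cts01 => s s01 /=; exact: (C1 _ _ _ (seg s s01)).2.
have [_ S] := unit_mean_sum (index_enum _) (fun kc => a kc.1 c kc.2) cf.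
rewrite pair_bigA/=; apply: (etrans (esym S)).
rewrite -[RHS](@unit_mean_cst R 0); apply: eq_unit_mean => s s01.
by rewrite -[RHS](e _ c (seg s s01)) /dirac pair_bigA.
Qed.

Lemma avgs_dirac_solution p r h ks F : 0 <= h ->
  dirac_solution (ball p (r + (size ks)%:R * h)) F ->
  dirac_solution (ball p r) (fun c => avgs h ks (F c)).
Proof.
move=> h0; elim: ks r => [|k ks IH] r /=; first by rewrite mul0r addr0.
rewrite (_ : r + _ = r + h + (size ks)%:R * h); last by rewrite -natr1; ring.
by move=> /IH; exact: avg_dirac_solution.
Qed.

End DiracSystem.

(** * The gradient estimate *)

Lemma is_derive_weighted_sum {R : realType} {V : normedModType R}
    (I : Type) (s : seq I) (w : I -> R) (f : I -> V -> R) (x v : V) (df : I -> R) :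
  (forall i, is_derive x v (f i) (df i)) ->
  is_derive x v (fun y => \sum_(i <- s) w i * f i y) (\sum_(i <- s) w i * df i).
Proof.
move=> Df; elim: s => [|i s IH].
  rewrite (_ : (fun y => _) = cst 0); last by apply/funext => t; rewrite big_nil.
  by rewrite big_nil; exact: is_derive_cst.
rewrite (_ : (fun y => _) = fun y => w i * f i y + \sum_(j <- s) w j * f j y);
  last first.
  by apply/funext => t; rewrite big_cons.
rewrite big_cons.
exact: (is_deriveD (f := w i \*: f i) (is_deriveZ _ (Df i)) IH).
Qed.

Lemma is_derive_increment_bound {R : realType} {n : nat} (u : 'rV[R]_n ->
  R) x v (l : R) :
  is_derive x v u l ->
  forall e, 0 < e -> exists2 d, 0 < d &
     forall t, `|t| < d -> `|u (x + t *: v) - u x - t * l| <= e * `|t|.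
Proof.
move=> [/cvgrPdist_le H E] e e0; have [d /= d0 {}H] := H e e0.
exists d => // t td; have [->|t0] := eqVneq t 0.
  by rewrite scale0r addr0 subrr mul0r subr0 normr0 mulr0.
have := H t; rewrite /= sub0r normrN => /(_ td t0).
rewrite -/(derive u x v) E distrC [t *: v + x]addrC -[_ *: _]/(_ * _) => {}H.
rewrite (_ : _ - t * l = (t^-1 * (u (x + t *: v) - u x) - l) * t).
  by rewrite normrM ler_wpM2r.
by rewrite mulrBl mulrAC mulVf// mul1r [l * t]mulrC.
Qed.

Section GradientBound.
Context {R : realType} {n N : nat}.
Local Notation X := 'rV[R]_n.
Implicit Types (x y z p : X) (k l m : 'I_n) (c : 'I_N) (h r : R) (W : set X).
Variables a b : 'I_n -> 'M[R]_N.
Implicit Types F G : 'I_N -> X -> R.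
Hypothesis clifford : forall k l,
  b k *m a l + b l *m a k = (if k == l then 2 else 0)%:M.

Lemma derive_dirac W F : open W -> (forall c m, C1_partials W (partial m (F c))) ->
  forall k x c, W x ->
    is_derive x (axis k) (fun y => dirac a F y c)
      (\sum_l \sum_c' a l c c' * partial k (partial l (F c')) x).
Proof.
move=> oW C2 k x c Wx; rewrite pair_bigA/=.
rewrite (_ : (fun y => _) = fun y =>
  \sum_(i : 'I_n * 'I_N) a i.1 c i.2 * partial i.1 (F i.2) y); last first.
  by apply/funext => y; rewrite /dirac pair_bigA.
apply: is_derive_weighted_sum => -[l c'] /=.
by apply: derivableP; exact: (C2 c' l k x Wx).1.
Qed.

Lemma dirac_partial W F : open W -> (forall c m, C1_partials W (partial m (F c))) ->
  dirac_solution a W F -> forall k x c, W x ->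
  \sum_l \sum_c' a l c c' * partial k (partial l (F c')) x = 0.
Proof.
move=> oW C2 [C1 e] k x c Wx.
have De := derive_dirac oW C2 k c Wx.
have D0 : is_derive x (axis k) (cst 0 : X ->
  R) (\sum_l \sum_c' a l c c' * partial k (partial l (F c')) x).
  by apply: (is_derive_eq_on oW Wx _ De) => y Wy; exact: e.
by rewrite -(@derive_val _ _ _ _ _ _ _ D0) derive_cst.
Qed.

(** Applying the conjugate system sum_k b_k d_k to the equation gives the Laplacian:
    the mixed derivatives are symmetric and the Clifford relations cancel them. *)
Lemma dirac_harmonic W F : open W -> (forall c m, C1_partials W (partial m (F c))) ->
  dirac_solution a W F -> forall c, harmonic_on W (F c).
Proof.
move=> oW C2 [C1 e] c0; split; [|split].
- by move=> x Wx; apply: (C1_continuous (C1 c0)); exact: open_nbhs_in.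
- by move=> m x Wx; split; [exact: (C1 c0 m x Wx).1|exact: (C2 c0 m m x Wx).1].
move=> x Wx.
pose d k l c : R := partial k (partial l (F c)) x.
have dsym k l : d k l = d l k.
  by apply/funext => c; exact: (@schwarz _ _ W (F c) l k x oW (C1 c) (C2 c) Wx).
pose D k l : 'cV[R]_N := \col_c d k l c.
have Dsym k l : D k l = D l k.
  by rewrite /D dsym.
have eqk k : \sum_l a l *m D k l = 0.
  apply/colP => c; rewrite summxE [RHS]mxE.
  rewrite -[RHS](dirac_partial oW C2 (conj C1 e) k c Wx).
  by apply: eq_bigr => l _; rewrite mxE; apply: eq_bigr => c' _;
    rewrite [D _ _ _ _]mxE.
have T : \sum_k \sum_l (b k *m a l) *m D k l = 0.
  apply: big1 => k _; under eq_bigr do rewrite -mulmxA.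
  by rewrite -mulmx_sumr eqk mulmx0.
have T' : \sum_k \sum_l (b l *m a k) *m D k l = 0.
  rewrite exchange_big/= -[RHS]T; apply: eq_bigr => k _; apply: eq_bigr => l _.
  by rewrite Dsym.
have : \sum_k \sum_l (b k *m a l + b l *m a k) *m D k l = 0.
  under eq_bigr do under eq_bigr do rewrite mulmxDl.
  under eq_bigr do rewrite big_split/=.
  by rewrite big_split/= T T' addr0.
have -> : \sum_k \sum_l (b k *m a l + b l *m a k) *m D k l = 2 *: \sum_k D k k.
  rewrite scaler_sumr; apply: eq_bigr => k _.
  rewrite (bigD1 k)//= big1 ?addr0 => [|l lk];
    first by rewrite clifford eqxx mul_scalar_mx.
  by rewrite clifford eq_sym (negbTE lk) mul_scalar_mx scale0r.
move=> /colP/(_ c0); rewrite !mxE summxE => /eqP.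
rewrite mulf_eq0 pnatr_eq0/= => /eqP H; rewrite -[RHS]H.
by apply: eq_bigr => k _; rewrite mxE.
Qed.

(** The averages of F over small cubes are componentwise harmonic, bounded by M, and
    converge to F pointwise, so that the bound of [harmonic_odd_bound] on symmetric
    differences holds for F itself. *)
Lemma gradient_upper_bound p r k c M F : 0 < M ->
  dirac_solution a (ball p r) F -> (forall x, ball p r x -> `|F c x| <= M) ->
  0 < r -> partial k (F c) p <= n.+1%:R * M / r.
Proof.
move=> M0 Fs FM r0.
have oB s : open (ball p s) by exact: ball_open.
have pp : ball p r p by exact: ballxx.
have difference d t : 0 < d < r -> 0 <= t <= d ->
    F c (p + t *: axis k) - F c (p - t *: axis k) <= 2 * (n.+1%:R * M / d) * t.
  move=> /andP[d0 dr] /andP[t0 td]; apply/ler_addgt0Pr => e e0.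
  pose ks := enum 'I_n.
  have e2 : 0 < e / 2 by rewrite divr_gt0.
  have inB s : `|s| <= d -> ball p r (p + s *: axis k).
    by move=> sd; apply: ball_axis; exact: le_lt_trans dr.
  have p1 : ball p r (p + t *: axis k) by apply: inB; rewrite ger0_norm.
  have p2 : ball p r (p - t *: axis k).
    by rewrite -scaleNr; apply: inB; rewrite normrN ger0_norm.
  have [h1 h10 H1] := avgs_close ks (oB r) p1 (Fs.1 c) e2.
  have [h2 h20 H2] := avgs_close ks (oB r) p2 (Fs.1 c) e2.
  pose s := (size ks).+1%:R : R; have s0 : 0 < s by [].
  pose m := Num.min (Num.min h1 h2) ((r - d) / s).
  have m0 : 0 < m by rewrite !lt_min h10 h20 divr_gt0// subr_gt0.
  (* The step h leaves room for size ks averages between d and r. *)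
  pose h := m / 2; have h0 : 0 < h by rewrite divr_gt0.
  have hm : h < m by rewrite /h; lra.
  have : h < m by []; rewrite /m !lt_min => /andP[/andP[hh1 hh2] hr].
  pose q := r - (size ks)%:R * h.
  have dq : d < q.
    move: hr; rewrite ltr_pdivlMr// /s -natr1 /q => ?; lra.
  have rE : r = q + (size ks)%:R * h by rewrite /q; ring.
  have Fs' := Fs; rewrite rE in Fs'.
  have Gs := avgs_dirac_solution (ltW h0) Fs'.
  have Gh : harmonic_on (ball p q) (avgs h ks (F c)).
    apply: (dirac_harmonic (F := fun c => avgs h ks (F c))) => // c' m'.
    by apply: avgs_C2 => //; [exact: Fs'.1|rewrite mem_enum].
  have GM x : ball p q x -> `|avgs h ks (F c) x| <= M.
    move=> px; rewrite ler_norml.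
    apply: (avgs_bounds (ltW h0) (Fs'.1 c) _ px).2 => y; rewrite -rE => /FM.
    by rewrite ler_norml.
  have dq' : 0 < d < q by rewrite d0.
  have td' : 0 <= t <= d by rewrite t0.
  have h1' : 0 < h < h1 by rewrite h0.
  have h2' : 0 < h < h2 by rewrite h0.
  have /ler_normlP[A1 A2] := H1 h h1'.
  have /ler_normlP[A3 A4] := H2 h h2'.
  have A5 := harmonic_odd_bound k dq' M0 Gh GM td'.
  clear - A1 A2 A3 A4 A5; lra.
have dF : is_derive p (axis k) (F c) (partial k (F c) p).
  by apply: derivableP; exact: (Fs.1 c k p pp).1.
have bound d : 0 < d < r -> partial k (F c) p <= n.+1%:R * M / d.
  move=> dr; have d0 : 0 < d by case/andP: dr.
  apply/ler_addgt0Pr => e e0.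
  have [t0 t00 H] := is_derive_increment_bound dF e0.
  pose t := Num.min t0 d / 2.
  have m0 : 0 < Num.min t0 d by rewrite lt_min t00.
  have tm : t < Num.min t0 d by rewrite /t; lra.
  have t_gt0 : 0 < t by rewrite divr_gt0.
  have [tt0 td] : t < t0 /\ t < d by move: tm; rewrite lt_min => /andP[].
  have nt : `|t| = t by rewrite ger0_norm// ltW.
  have := H t; rewrite nt => /(_ tt0) H1.
  have := H (- t); rewrite normrN nt => /(_ tt0) H2.
  rewrite scaleNr mulNr opprK in H2.
  have := difference d t dr; rewrite (ltW t_gt0) (ltW td) => /(_ isT) H3.
  rewrite -(ler_pM2r t_gt0).
  move: H1 H2 => /ler_normlP[H1 _] /ler_normlP[_ H2].
  rewrite mulrDl; clear - H1 H2 H3; lra.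
rewrite leNgt; apply/negP; rewrite ltr_pdivrMr// => H.
set D := partial k (F c) p in H bound.
set B := n.+1%:R * M in H bound.
have B0 : 0 < B by rewrite mulr_gt0.
have D0 : 0 < D by rewrite -(pmulr_lgt0 _ r0) (lt_trans B0).
have Br : B / D < r by rewrite ltr_pdivrMr// mulrC.
have BD : 0 < B / D by rewrite divr_gt0.
have mid : 0 < (B / D + r) / 2 < r by apply/andP; split; lra.
have := bound _ mid; rewrite ler_pdivlMr; last by case/andP: mid.
have DB : D * (B / D) = B by rewrite mulrC divfK// gt_eqF.
have -> : D * ((B / D + r) / 2) = (D * (B / D) + D * r) / 2 by ring.
rewrite DB; lra.
Qed.

(** The lower bound is the upper bound for -F. *)
Lemma gradient_bound W p r k c M F : 0 < r -> 0 < M -> ball p r `<=` W ->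
  dirac_solution a W F -> (forall x, ball p r x -> `|F c x| <= M) ->
  `|partial k (F c) p| <= n.+1%:R * M / r.
Proof.
move=> r0 M0 rW /(dirac_solution_subset rW) Fs FM.
rewrite ler_norml (gradient_upper_bound k M0 Fs FM r0) andbT lerNl.
have oB : open (ball p r) by exact: ball_open.
have Gs := dirac_solution_lincomb (-1) 0 oB Fs Fs.
have pp : ball p r p by exact: ballxx.
have -> : - partial k (F c) p = partial k (fun x => (-1) * F c x + 0 * F c x) p.
  have dF := derivableP (Fs.1 c k p pp).1.
  rewrite [RHS](@derive_val _ _ _ _ _ _ _ (is_derive_lincomb (-1) 0 dF dF)).
  by rewrite mulN1r mul0r addr0.
apply: (gradient_upper_bound k M0 Gs _ r0) => x /FM.
by rewrite mul0r addr0 mulN1r normrN.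
Qed.

End GradientBound.

(** * Smoothness of solutions *)

Lemma ltr_dist_thirds (R : realFieldType) (A B C D e : R) :
  `|A - C| <= e / 3 -> `|B - D| <= e / 3 -> `|A - B| < e / 3 -> `|C - D| < e.
Proof.
move=> /ler_normlP[? ?] /ler_normlP[? ?] /ltr_normlP[? ?].
by rewrite ltr_norml; apply/andP; split; lra.
Qed.

Section Smoothness.
Context {R : realType} {n N : nat}.
Local Notation X := 'rV[R]_n.
Implicit Types (x y z p : X) (k l m : 'I_n) (c : 'I_N) (h r s t : R) (W : set X).
Variables a b : 'I_n -> 'M[R]_N.
Implicit Types F G : 'I_N -> X -> R.
Hypothesis clifford : forall k l,
  b k *m a l + b l *m a k = (if k == l then 2 else 0)%:M.

Definition diff_quot k s (u : X -> R) x : R :=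
  s^-1 * u (x + s *: axis k) + (- s^-1) * u x.

Lemma diff_quot_cvg (u : X -> R) k y (l' : R) : is_derive y (axis k) u l' ->
  forall e, 0 < e ->
  exists2 d, 0 < d & forall h, h != 0 -> `|h| < d -> `|diff_quot k h u y - l'| <= e.
Proof.
move=> Du e e0; have [d d0 H] := is_derive_increment_bound Du e0.
exists d => // h h0 /H {}H.
rewrite (_ : _ - l' = (u (y + h *: axis k) - u y - h * l') / h).
  by rewrite normrM normfV ler_pdivrMr ?normr_gt0.
by rewrite /diff_quot; field.
Qed.

(** By the mean value theorem, from the uniform continuity of the partial derivative
    on K. *)
Lemma diff_quot_uniform W u k (K : set X) e : open W -> C1_partials W u ->
  compact K -> K `<=` W -> 0 < e ->
  exists2 d, 0 < d & forall s x, K x -> s != 0 -> `|s| < d ->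
    (forall t, `|t| <= `|s| -> W (x + t *: axis k)) ->
    `|diff_quot k s u x - partial k u x| <= e.
Proof.
move=> oW C1 cK KW e0.
have [d d0 H] := uniform_continuity cK (fun x Kx => (C1 k x (KW x Kx)).2) e0.
exists d => // s x Kx s0 sd Wx.
have as_le (q : R) : 0 <= q <= 1 -> `|q * s| <= `|s|.
  by move=> /andP[q0 q1]; rewrite normrM ler_piMl// ger0_norm.
have [q q01 E] : exists2 q, 0 <= q <= 1 &
    u (x + s *: axis k) - u x = partial k u (x + (q * s) *: axis k) * s.
  by apply: mvt_line => q q01; exact: (C1 k _ (Wx _ (as_le q q01))).1.
rewrite /diff_quot mulNr -mulrBr E mulrCA mulVf// mulr1 ltW//.
by apply: H => //; apply: ball_axis; exact: le_lt_trans (as_le q q01) sd.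
Qed.

Lemma partial_diff_quot W u k l s x : C1_partials W u -> W x -> W (x + s *: axis k) ->
  partial l (diff_quot k s u) x = diff_quot k s (partial l u) x.
Proof.
move=> C1 Wx Wxs; rewrite /partial; apply: derive_val.
apply: is_derive_lincomb; last by apply: derivableP; exact: (C1 l x Wx).1.
by apply: is_derive_translate; apply: derivableP; exact: (C1 l _ Wxs).1.
Qed.

Lemma diff_quot_dirac_solution W W' F k s : open W' -> W' `<=` W ->
  (forall x, W' x -> W (x + s *: axis k)) ->
  dirac_solution a W F -> dirac_solution a W' (fun c => diff_quot k s (F c)).
Proof.
move=> oW' WW Wt Fs; apply: dirac_solution_lincomb => //.
  exact: dirac_solution_translate Wt Fs.
exact: dirac_solution_subset Fs.
Qed.

(** Difference quotients of F are solutions and form a uniform Cauchy family, since F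
    is C^1. The gradient estimate transfers this to their derivatives, which are the
    difference quotients of the derivatives of F. *)
Lemma diff_quot_cauchy W F p r k l c : dirac_solution a W F -> open W -> 0 < r ->
  ball p (4 * r) `<=` W -> forall e, 0 < e -> exists2 d, 0 < d &
    forall s t y, s != 0 -> t != 0 -> `|s| < d -> `|t| < d -> ball p r y ->
      `|diff_quot k s (partial l (F c)) y - diff_quot k t (partial l (F c)) y| <= e.
Proof.
move=> Fs oW r0 pW e e0.
have KW : closed_cube p (2 * r) `<=` W.
  move=> y py; apply: pW; rewrite (_ : 4 * r = r + (r + 2 * r)); last by ring.
  have pp : ball p r p by exact: ballxx.
  apply: (@le_ball _ _ _ (r + 2 * r)); first by rewrite lerDr ltW.
  by apply: closed_cube_ball pp py; rewrite mulr_ge0// ltW.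
have balls y s : ball p (3 * r) y -> `|s| < r -> ball p (4 * r) (y + s *: axis k).
  move=> py sr; rewrite (_ : 4 * r = 3 * r + r); last by ring.
  exact: ball_triangle py (ball_axis _ _ sr).
have cb y : ball p (2 * r) y -> closed_cube p (2 * r) y.
  by move=> /ball_rVP[_ py] i; exact: ltW.
have b23 y : ball p (2 * r) y -> ball p (3 * r) y.
  by apply: le_ball; rewrite ler_pM2r// ler_nat.
have b34 y : ball p (3 * r) y -> ball p (4 * r) y.
  by apply: le_ball; rewrite ler_pM2r// ler_nat.
pose M := e * r / n.+1%:R.
have M0 : 0 < M by rewrite divr_gt0// mulr_gt0.
have M2 : 0 < M / 2 by rewrite divr_gt0.
have [d d0 H] := diff_quot_uniform k oW (Fs.1 c) (@closed_cube_compact _ _ p (2 *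
  r)) KW M2.
exists (Num.min d r); first by rewrite lt_min d0.
move=> s t y s0 t0; rewrite !lt_min => /andP[sd sr] /andP[td tr] py.
have sol q : `|q| < r -> dirac_solution a (ball p (3 * r)) (fun c =>
  diff_quot k q (F c)).
  move=> qr; apply: (@diff_quot_dirac_solution W) Fs; first exact: ball_open.
    by move=> z /b34 /pW.
  by move=> z pz; apply: pW; exact: balls.
have oB : open (ball p (3 * r)) by exact: ball_open.
have sol2 := dirac_solution_lincomb 1 (-1) oB (sol s sr) (sol t tr).
have yr : ball y r `<=` ball p (2 * r).
  move=> z yz; rewrite (_ : 2 * r = r + r); last by ring.
  exact: ball_triangle py yz.
have yr3 : ball y r `<=` ball p (3 * r) by move=> z /yr /b23.
have bnd z : ball y r z -> `|1 * diff_quot k s (F c) z +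
  (-1) * diff_quot k t (F c) z| <= M.
  move=> /yr pz; rewrite mul1r mulN1r.
  have Wz (q : R) : `|q| < r -> forall t : R, `|t| <= `|q| -> W (z + t *: axis k).
    by move=> qr u uq; apply: pW; apply: balls; [exact: b23|exact: le_lt_trans uq qr].
  have := H s z (cb z pz) s0 sd (Wz s sr).
  have := H t z (cb z pz) t0 td (Wz t tr).
  move=> h1 h2; rewrite -(subrKA (partial k (F c) z)).
  apply: (le_trans (ler_normD _ _)); rewrite [X in _ + X]distrC.
  clear - h1 h2; lra.
have := gradient_bound clifford l (c := c) r0 M0 yr3 sol2 bnd.
have p3 : ball p (3 * r) y by apply: b23; apply: yr; exact: ballxx.
have Wy := pW _ (b34 _ p3).
have Wys := pW _ (balls _ _ p3 sr).
have Wyt := pW _ (balls _ _ p3 tr).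
have -> : partial l (fun x => 1 * diff_quot k s (F c) x +
  (-1) * diff_quot k t (F c) x) y =
    diff_quot k s (partial l (F c)) y - diff_quot k t (partial l (F c)) y.
  rewrite -(partial_diff_quot l (Fs.1 c) Wy Wys) -(partial_diff_quot l (Fs.1 c) Wy
    Wyt).
  rewrite /partial; have -> : forall A B : R, A - B = 1 * A + (-1) * B by move=> *;
    ring.
  apply: derive_val; apply: is_derive_lincomb; apply: derivableP.
    exact: ((sol s sr).1 c l y p3).1.
  exact: ((sol t tr).1 c l y p3).1.
by rewrite /M [n.+1%:R * _]mulrC !divfK// ?gt_eqF// -mulrA divff ?mulr1// gt_eqF.
Qed.

(** The difference quotients of a derivative of F converge locally uniformly, so that
    they have a limit and this limit is continuous. *)
Lemma dirac_solution_C2 W F : open W -> dirac_solution a W F ->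
  forall c l, C1_partials W (partial l (F c)).
Proof.
move=> oW Fs c l k x Wx.
have [d0 d00 dW] := open_ball_in oW Wx.
pose r := d0 / 4; have r0 : 0 < r by rewrite divr_gt0.
have pW : ball x (4 * r) `<=` W by rewrite /r mulrC divfK.
pose v := partial l (F c).
have cauchyv := diff_quot_cauchy k l c Fs oW r0 pW.
have quotE y : (fun h : R => h^-1 *: ((v \o shift y) (h *: axis k) - v y)) =
    (fun h => diff_quot k h v y).
  by apply/funext => h; rewrite /diff_quot /= mulNr -mulrBr [_ + y]addrC.
have dv y : ball x r y -> derivable v y (axis k).
  move=> py; rewrite /derivable quotE.
  have C : cauchy_ex (diff_quot k h v y @[h --> (0:R)^']).
    move=> e e0; have e2 : 0 < e / 2 by rewrite divr_gt0.
    have [d d0' H] := cauchyv _ e2.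
    have nd : `|d / 2| < d by rewrite ger0_norm ?divr_ge0// ?ltW//; lra.
    have dn0 : d / 2 != 0 by rewrite gt_eqF// divr_gt0.
    exists (diff_quot k (d / 2) v y); exists d => //= h /=;
      rewrite sub0r normrN => hd h0.
    by apply: (le_lt_trans (H _ _ _ dn0 h0 nd hd py)); lra.
  exact: cauchy_cvg (cauchy_exP _ C).
have limv e : 0 < e -> exists2 d, 0 < d & forall s y, s != 0 -> `|s| < d ->
  ball x r y ->
    `|diff_quot k s v y - partial k v y| <= e.
  move=> e0; have e2 : 0 < e / 2 by rewrite divr_gt0.
  have [d d0' H] := cauchyv _ e2; exists d => // s y s0 sd py.
  have [d' d'0 H'] := diff_quot_cvg (derivableP (dv y py)) e2.
  pose m := Num.min d d'; have m0 : 0 < m by rewrite lt_min d0'.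
  pose h := m / 2; have h0 : 0 < h by rewrite divr_gt0.
  have hm : h < m by rewrite /h; lra.
  have [hd hd'] : h < d /\ h < d' by move: hm; rewrite lt_min => /andP[].
  have nh : `|h| = h by rewrite ger0_norm// ltW.
  have hn0 : h != 0 by rewrite gt_eqF.
  have A1 := H s h y s0 hn0 sd; rewrite nh in A1.
  have A2 := H' h hn0; rewrite nh in A2.
  rewrite -(subrKA (diff_quot k h v y)); apply: (le_trans (ler_normD _ _)).
  by rewrite (splitr e) lerD// ?A1// A2.
have Wv y : ball x r y -> W y.
  by move=> py; apply: pW; apply: le_ball py; rewrite ler_peMl ?ler1n// ltW.
have pxx : ball x r x by exact: ballxx.
split; first exact: dv.
apply/continuous_ballP => e e0.
have e3 : 0 < e / 3 by rewrite divr_gt0.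
have [d d0' H] := limv _ e3.
pose m := Num.min d r; have m0 : 0 < m by rewrite lt_min d0'.
pose s := m / 2; have s0 : 0 < s by rewrite divr_gt0.
have sm : s < m by rewrite /s; lra.
have [sd sr] : s < d /\ s < r by move: sm; rewrite lt_min => /andP[].
have ns : `|s| = s by rewrite ger0_norm// ltW.
have cv y : W y -> {for y, continuous v} by move=> Wy; exact: (Fs.1 c l y Wy).2.
have Wxs : W (x + s *: axis k).
  by apply: Wv; apply: ball_axis; rewrite ns.
have cq : {for x, continuous (diff_quot k s v)}.
  have c1 : {for x, continuous (fun y => v (y + s *: axis k))}.
    have ci : {for x, continuous (@id X)} by [].
    have cc : {for x, continuous (fun=> s *: axis k : X)} by exact: cst_continuous.
    exact: (continuous_comp (continuousD ci cc) (cv _ Wxs)).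
  have ca (q : R) : {for x, continuous (fun=> q)} by exact: cst_continuous.
  exact: (continuousD (continuousM (ca _) c1) (continuousM (ca _) (cv x Wx))).
have /continuous_ballP/(_ _ e3)[d1 d10 H1] := cq.
exists (Num.min d1 r); first by rewrite lt_min d10.
move=> y xy.
have yr : ball x r y by apply: le_ball xy; rewrite ge_min lexx orbT.
have y1 : ball x d1 y by apply: le_ball xy; rewrite ge_min lexx.
have sn0 : s != 0 by rewrite gt_eqF.
have nsd : `|s| < d by rewrite ns.
have A1 := H s y sn0 nsd yr.
have A2 := H s x sn0 nsd pxx.
have A3 := H1 y y1.
exact: (ltr_dist_thirds A1 A2 A3).
Qed.

(** The system may be differentiated, by [dirac_solution_C2] and Schwarz. Iterating
    this shows that solutions are smooth. *)
Lemma dirac_solution_partial W F k : open W -> dirac_solution a W F ->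
  dirac_solution a W (fun c => partial k (F c)).
Proof.
move=> oW Fs; have C2 := dirac_solution_C2 oW Fs; split => [c|x c Wx];
  first exact: C2.
apply: (etrans _ (dirac_partial oW C2 Fs k c Wx)); rewrite /dirac.
have E l c' : partial l (partial k (F c')) x = partial k (partial l (F c')) x.
  exact: (@schwarz _ _ W (F c') k l x oW (Fs.1 c') (C2 c') Wx).
by apply: eq_bigr => l _; apply: eq_bigr => c' _; rewrite E.
Qed.

End Smoothness.

(** * Flat points and unique continuation *)

Section TaylorFlat.
Context {R : realType}.

Lemma le_of_derivative_le (f g df dg : R -> R) :
  (forall s : R, 0 <= s <= 1 -> is_derive s 1 f (df s)) ->
  (forall s : R, 0 <= s <= 1 -> is_derive s 1 g (dg s)) ->
  (forall s : R, 0 <= s <= 1 -> df s <= dg s) -> f 0 = g 0 ->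
  forall s : R, 0 <= s <= 1 -> f s <= g s.
Proof.
move=> Df Dg le fg0 s /andP[s0 s1].
have Dh (t : R) : 0 <= t <= 1 -> is_derive t 1 (g - f) (dg t - df t).
  by move=> t01; exact: (is_deriveB (Dg t t01) (Df t t01)).
have sub (t : R) : t \in `[0, s] -> 0 <= t <= 1.
  by rewrite in_itv/= => /andP[-> ts]; rewrite (le_trans ts).
have [|||c cs] := @MVT_segment _ (g - f) (fun t => dg t - df t) 0 s.
- by [].
- by move=> t ts; apply/Dh/sub; exact: subset_itv_oo_cc.
- by apply: derivable_within_continuous => t ts; have [] := Dh t (sub t ts).
rewrite !fctE fg0 subrr !subr0 => E.
by rewrite -subr_ge0 E mulr_ge0// subr_ge0 le// sub.
Qed.

(** Each step from G j.+1 to G j integrates a power of s;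
    this produces the factorial. *)
Lemma taylor_flat (G : nat -> R -> R) m B :
  (forall j (s : R), 0 <= s <= 1 -> is_derive s 1 (G j) (G j.+1 s)) ->
  (forall j, G j 0 = 0) -> (forall s : R, 0 <= s <= 1 -> `|G m s| <= B) ->
  `|G 0%N 1| <= B / m`!%:R.
Proof.
move=> DG G0 GB.
suff H j : (j <= m)%N -> forall s : R, 0 <= s <= 1 ->
  `|G (m - j)%N s| <= B / j`!%:R * s ^+ j.
  have := H m (leqnn m) 1; rewrite subnn expr1n mulr1; apply.
  by rewrite ler01 lexx.
elim: j => [_ s s01|j IH jm s s01]; first by rewrite subn0 fact0 divr1 expr0 mulr1 GB.
have mj : (m - j = (m - j.+1).+1)%N by rewrite subnSK.
have {}IH := IH (ltnW jm); rewrite mj in IH.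
set g := G (m - j.+1)%N in IH *.
pose h (c : R) t := c * t ^+ j.+1.
pose b := B / j.+1`!%:R.
have Dh (c t : R) : is_derive t 1 (h c) (c * (j.+1%:R * t ^+ j)).
  have -> : h c = horner (c%:P * 'X^(j.+1)) by apply/funext => q; rewrite /h !hornerE.
  have -> : c * (j.+1%:R * t ^+ j) = (c%:P * 'X^(j.+1))^`().[t].
    by rewrite derivM derivC mul0r add0r derivXn hornerM hornerC hornerMn hornerXn
      mulr_natl.
  exact: is_derive_poly.
have bE (t : R) : b * (j.+1%:R * t ^+ j) = B / j`!%:R * t ^+ j.
  rewrite mulrA /b; congr (_ * _); rewrite factS natrM; field.
  by rewrite nat1r !pnatr_eq0 -lt0n fact_gt0.
have Dg (t : R) : 0 <= t <= 1 -> is_derive t 1 g (G (m - j.+1).+1 t) by move=> t01;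
  exact: DG.
rewrite -/b ler_norml; apply/andP; split.
  have -> : - (b * s ^+ j.+1) = h (- b) s by rewrite /h mulNr.
  apply: (le_of_derivative_le (fun t _ => Dh (- b) t) Dg) => //.
    by move=> t /IH; rewrite mulNr bE ler_norml => /andP[].
  by rewrite /h expr0n mulr0 /g G0.
apply: (le_of_derivative_le Dg (fun t _ => Dh b t)) => //.
  by move=> t /IH; rewrite bE ler_norml => /andP[].
by rewrite /h expr0n mulr0 /g G0.
Qed.

(** One term of the exponential series of m.+1. *)
Lemma power_le_fact m : (m.+1%:R ^+ m : R) <= expR 1 ^+ m.+1 * m`!%:R.
Proof.
rewrite -expRM_natl mulr1; case: m => [|m].
  by rewrite expr0 fact0 mulr1 -expR0 ler_expR.
rewrite -ler_pdivrMr ?ltr0n ?fact_gt0//.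
apply: le_trans (expR_ge1Dxn m (ler0n _ _)).
by rewrite lerDr.
Qed.

End TaylorFlat.

Section Flatness.
Context {R : realType} {n N : nat}.
Local Notation X := 'rV[R]_n.
Implicit Types (x y z p : X) (k l : 'I_n) (c : 'I_N) (h r s t : R) (W : set X).
Variables a b : 'I_n -> 'M[R]_N.
Implicit Types F G : 'I_N -> X -> R.
Hypothesis clifford : forall k l,
  b k *m a l + b l *m a k = (if k == l then 2 else 0)%:M.

Definition iter_partial (ks : seq 'I_n) F : 'I_N -> X -> R :=
  foldr (fun k G c => partial k (G c)) F ks.

(** Vanishing to infinite order. *)
Definition flat F : set X := [set x | forall ks c, iter_partial ks F c x = 0].

Lemma iter_partial_cat ks ls F :
  iter_partial (ks ++ ls) F = iter_partial ks (iter_partial ls F).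
Proof. by rewrite /iter_partial foldr_cat. Qed.

Lemma iter_partial_solution W F ks : open W -> dirac_solution a W F ->
  dirac_solution a W (iter_partial ks F).
Proof.
move=> oW Fs; elim: ks => [|k ks IH] //=.
exact: (dirac_solution_partial clifford k oW IH).
Qed.

Lemma flat_iter_partial F x ks : flat F x -> flat (iter_partial ks F) x.
Proof. by move=> Fx ls c; rewrite -iter_partial_cat. Qed.

(** Each derivative is estimated on a ball whose radius is smaller by r / (m + 1), and
    costs a factor (n + 1) (m + 1) / r. *)
Lemma iterated_gradient_bound W F p r k c M m : open W -> dirac_solution a W F ->
  0 < r -> 0 < M -> ball p r `<=` W -> (forall y, ball p r y -> `|F c y| <= M) ->
  `|iter_partial (nseq m k) F c p| <= (n.+1%:R * m.+1%:R / r) ^+ m * M.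
Proof.
move=> oW Fs r0 M0 pW FM.
(* m.+1 rather than m: the last ball keeps the positive radius q. *)
pose q := r / m.+1%:R; have q0 : 0 < q by rewrite divr_gt0.
have qE : m.+1%:R * q = r by rewrite mulrC divfK// pnatr_eq0.
have CE : n.+1%:R * m.+1%:R / r = n.+1%:R / q by rewrite /q invf_div mulrA.
rewrite CE; set A := n.+1%:R / q; have A0 : 0 < A by rewrite divr_gt0.
suff H j : (j <= m)%N -> forall y, ball p ((m.+1 - j)%:R * q) y ->
    `|iter_partial (nseq j k) F c y| <= A ^+ j * M.
  by apply: (H m (leqnn m)); rewrite subSnn mul1r; exact: ballxx.
elim: j => [_|j IH jm] y.
  by rewrite subn0 qE expr0 mul1r; exact: FM.
have mj : (m.+1 - j = (m.+1 - j.+1).+1)%N by rewrite subnSK// ltnW.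
move=> py.
have yq z : ball y q z -> ball p ((m.+1 - j)%:R * q) z.
  by rewrite mj -natr1 mulrDl mul1r; exact: ball_triangle.
have yW : ball y q `<=` W.
  move=> z /yq pz; apply: pW; apply: le_ball pz.
  by rewrite -qE ler_pM2r// ler_nat leq_subr.
have AM : 0 < A ^+ j * M by rewrite mulr_gt0// exprn_gt0.
have := gradient_bound clifford k q0 AM yW (iter_partial_solution (nseq j k) oW Fs)
  (fun z yz => IH (ltnW jm) z (yq z yz)).
by rewrite /= exprS mulrAC -/A mulrA.
Qed.

Lemma solution_bounded W F (K : set X) : open W -> dirac_solution a W F ->
  compact K -> K `<=` W -> exists2 M, 0 < M & forall c x, K x -> `|F c x| <= M.
Proof.
move=> oW Fs cK KW.
have H c : exists2 M, 0 < M & forall x, K x -> `|F c x| <= M.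
  have [K0|K0] := pselect (K !=set0); last first.
    by exists 1 => // x Kx; exfalso; apply: K0; exists x.
  have cF : {within K, continuous (fun x => `|F c x|)}.
    apply: continuous_in_subspaceT => x; rewrite inE => /KW Wx.
    have cF : {for x, continuous (F c)}.
      by apply: (C1_continuous (Fs.1 c)); exact: open_nbhs_in.
    exact: (continuous_comp cF (@norm_continuous _ _ _)).
  have [x0 x0K H] := EVT_max_rV K0 cK cF.
  exists (`|F c x0| + 1); first by rewrite ltr_wpDl.
  by move=> x Kx; rewrite (le_trans (H x _)) ?lerDl// inE.
have /choice[M HM] : forall c, exists M, 0 < M /\ forall x, K x -> `|F c x| <= M.
  by move=> c; have [M M0 HM] := H c; exists M.
exists (1 + \sum_c M c).
  by rewrite ltr_pwDl// sumr_ge0// => c _; exact: ltW (HM c).1.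
move=> c x Kx; apply: (le_trans ((HM c).2 x Kx)).
rewrite (bigD1 c)//= addrCA lerDl addr_ge0// sumr_ge0// => c' _; exact: ltW (HM c').1.
Qed.

(** The ratio of the radius on which a flat solution vanishes to the radius of a ball
    on which it is defined, chosen so that the Taylor remainder of order m is
    O(2^-m). *)
Definition flat_ratio : R := (2 * (n.+1%:R * expR 1))^-1.

Lemma flat_ratio_gt0 : 0 < flat_ratio.
Proof. by rewrite invr_gt0 !mulr_gt0 ?expR_gt0. Qed.

Lemma flat_ratio_lt1 : flat_ratio < 1.
Proof.
rewrite invf_lt1 ?mulr_gt0 ?expR_gt0//.
have h1 : 1 <= n.+1%:R :> R by rewrite ler1n.
have h2 : 1 <= expR 1 :> R by rewrite -expR0 ler_expR.
have : 1 <= n.+1%:R * expR 1 :> R by rewrite mulr_ege1.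
lra.
Qed.

Lemma flat_line W F p r k t c : open W -> dirac_solution a W F -> 0 < r ->
  ball p (3 * r) `<=` W -> flat F p -> `|t| <= flat_ratio * r ->
  F c (p + t *: axis k) = 0.
Proof.
move=> oW Fs r0 pW Fp tr.
have tr' : `|t| < r.
  by apply: (le_lt_trans tr); rewrite gtr_pMl// flat_ratio_lt1.
have KW : closed_cube p (2 * r) `<=` W.
  move=> y py; apply: pW; rewrite (_ : 3 * r = r + 2 * r); last by ring.
  have pp : ball p r p by exact: ballxx.
  by apply: closed_cube_ball pp py; rewrite mulr_ge0// ltW.
have [M M0 HM] := solution_bounded oW Fs (@closed_cube_compact _ _ p (2 * r)) KW.
have pt (s : R) : 0 <= s <= 1 -> ball p r (p + (s * t) *: axis k).
  move=> /andP[s0 s1]; apply: ball_axis; apply: le_lt_trans tr'.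
  by rewrite normrM ler_piMl// ger0_norm.
have b2 y z : ball p r y -> ball y r z -> closed_cube p (2 * r) z.
  move=> py yz; have /ball_rVP[_ H] : ball p (2 * r) z.
    by rewrite (_ : 2 * r = r + r); [exact: ball_triangle yz|ring].
  by move=> i; exact: ltW.
have main m : `|F c (p + t *: axis k)| <= (M * expR 1) / 2 ^+ m.
  (* The factor t ^+ j makes G j.+1 the derivative of G j for the parameter s. *)
  pose G j s := t ^+ j * iter_partial (nseq j k) F c (p + (s * t) *: axis k).
  have Wy y : ball p r y -> W y.
    by move=> py; apply: KW; apply: (b2 _ _ py); exact: ballxx.
  have DG j (s : R) : 0 <= s <= 1 -> is_derive s 1 (G j) (G j.+1 s).
    move=> s01.
    have D1 := ((iter_partial_solution (nseq j k) oW Fs).1 c k _ (Wy _ (pt s s01))).1.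
    have D2 := is_derive_line D1.
    have D3 : is_derive s 1 (fun s : R => s * t) t.
      by apply: is_derive_eq; rewrite scaler0 add0r [_ *: _]mulr1.
    have D4 := @is_derive1_comp R (fun s : R =>
      iter_partial (nseq j k) F c (p + s *: axis k))
      (fun s => s * t) s _ _ D2 D3.
    have := is_deriveZ (t ^+ j) D4.
    rewrite (_ : t ^+ j *: _ = G j.+1 s); first by [].
    by rewrite /G exprS -[_ *: _]/(_ * _) /= /partial; ring.
  have G0 j : G j 0 = 0.
    by rewrite /G mul0r scale0r addr0 Fp mulr0.
  have GB (s : R) : 0 <= s <= 1 ->
    `|G m s| <= `|t| ^+ m * ((n.+1%:R * m.+1%:R / r) ^+ m * M).
    move=> s01; rewrite /G normrM normrX ler_wpM2l ?exprn_ge0//.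
    apply: (iterated_gradient_bound k m oW Fs r0 M0).
      by move=> z /(b2 _ _ (pt s s01)); exact: KW.
    by move=> z /(b2 _ _ (pt s s01)) /HM.
  have := taylor_flat DG G0 GB.
  rewrite /G expr0 !mul1r => /le_trans; apply.
  rewrite ler_pdivrMr ?ltr0n ?fact_gt0//.
  have E : `|t| ^+ m * ((n.+1%:R * m.+1%:R / r) ^+ m * M) =
     (`|t| * n.+1%:R / r) ^+ m * M * m.+1%:R ^+ m.
    rewrite !exprMn; ring.
  rewrite E.
  have q0 : 0 <= `|t| * n.+1%:R / r by rewrite divr_ge0 ?mulr_ge0// ltW.
  have qle : `|t| * n.+1%:R / r <= (2 * expR 1)^-1.
    have e0 : expR 1 != 0 :> R by rewrite gt_eqF// expR_gt0.
    have -> : (2 * expR 1)^-1 = flat_ratio * n.+1%:R.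
      rewrite /flat_ratio (_ : 2 * (n.+1%:R * expR 1) = n.+1%:R * (2 * expR 1));
        last by ring.
      by rewrite [in RHS]invfM mulrAC mulVf ?mul1r// pnatr_eq0.
    by rewrite ler_pdivrMr// mulrAC ler_pM2r.
  have := power_le_fact m => PF.
  apply: (@le_trans _ _ ((2 * expR 1)^-1 ^+ m * M * (expR 1 ^+ m.+1 * m`!%:R))).
    apply: ler_pM => //.
    - by rewrite mulr_ge0// ?exprn_ge0// ltW.
    - by rewrite ler_pM2r// lerXn2r// nnegrE invr_ge0 mulr_ge0// expR_ge0.
    - exact: PF.
  rewrite exprVn exprMn invfM [expR 1 ^+ m.+1]exprS.
  have e0 : expR 1 ^+ m != 0 :> R by rewrite expf_neq0// gt_eqF// expR_gt0.
  rewrite le_eqVlt; apply/orP; left; apply/eqP.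
  rewrite -[RHS](mulfK e0); set A := expR 1 ^+ m; set B := expR 1.
  by rewrite [A^-1]lock; ring.
apply/eqP; rewrite -normr_le0; apply/ler_addgt0Pr => e e0; rewrite add0r.
set K := M * expR 1 in main.
have K0 : 0 < K by rewrite mulr_gt0// expR_gt0.
have [m Hm] : exists m : nat, K / e < m%:R.
  by exists (Num.bound (K / e)); apply: archi_boundP; rewrite divr_ge0// ltW.
apply: (le_trans (main m)); rewrite ler_pdivrMr ?exprn_gt0//.
rewrite -ler_pdivrMl// mulrC (le_trans (ltW Hm))//.
by rewrite -natrX ler_nat ltnW// ltn_expl.
Qed.

Lemma flat_line_flat W F p r k t : open W -> dirac_solution a W F -> 0 < r ->
  ball p (3 * r) `<=` W -> flat F p -> `|t| <= flat_ratio * r ->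
  flat F (p + t *: axis k).
Proof.
move=> oW Fs r0 pW Fp tr ks c.
by apply: (flat_line k c oW (iter_partial_solution ks oW Fs) r0 pW _ tr);
  exact: flat_iter_partial.
Qed.

(** The path from p to y changes one coordinate at a time; by [flat_line_flat], flatness
    is inherited along each edge. *)
Lemma flat_nbhs W F p r : open W -> dirac_solution a W F -> 0 < r ->
  ball p (4 * r) `<=` W -> flat F p -> ball p (flat_ratio * r) `<=` flat F.
Proof.
move=> oW Fs r0 pW Fp y /ball_rVP[rho0 py].
pose z (j : nat) : X := \row_i (if (i < j)%N then y 0 i else p 0 i).
suff H j : (j <= n)%N -> flat F (z j).
  have := H n (leqnn n); rewrite (_ : z n = y)//.
  by apply/rowP => i; rewrite mxE ltn_ord.
elim: j => [_|j IH jn].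
  by rewrite (_ : z 0%N = p)//; apply/rowP => i; rewrite mxE.
pose k := Ordinal jn.
have -> : z j.+1 = z j + (y 0 k - p 0 k) *: axis k.
  apply/rowP => i; rewrite !mxE eqxx/= ltnS leq_eqVlt.
  have [->|ik] := eqVneq i k; first by rewrite /= eqxx ltnn mulr1 addrCA subrr addr0.
  by rewrite (_ : (i == j :> nat) = false) ?mulr0 ?addr0//; apply/negbTE.
apply: (flat_line_flat k oW Fs r0 _ (IH (ltnW jn))); last by rewrite distrC ltW.
have pz : ball p r (z j).
  apply/ball_rVP; split => // i; rewrite mxE; case: ifP => _;
    last by rewrite subrr normr0.
  by apply: (lt_trans (py i)); rewrite gtr_pMl// flat_ratio_lt1.
move=> x zx; apply: pW; rewrite (_ : 4 * r = r + 3 * r); last by ring.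
exact: ball_triangle pz zx.
Qed.

Lemma open_flat W F : open W -> dirac_solution a W F -> open (W `&` flat F).
Proof.
move=> oW Fs; rewrite openE => p [Wp Fp].
have [d d0 dW] := open_ball_in oW Wp.
pose r := d / 4; have r0 : 0 < r by rewrite divr_gt0.
have pW : ball p (4 * r) `<=` W by rewrite mulrC divfK.
apply/nbhs_ballP; exists (flat_ratio * r);
  first by rewrite /= mulr_gt0// flat_ratio_gt0.
move=> y py; split; last exact: (flat_nbhs oW Fs r0 pW Fp).
apply: pW; apply: le_ball py.
by rewrite ler_pM2r// (le_trans (ltW flat_ratio_lt1))// ler1n.
Qed.

(** An iterated derivative that is nonzero at p is nonzero around p. *)
Lemma open_not_flat W F : open W -> dirac_solution a W F -> open (W `\` flat F).
Proof.
move=> oW Fs; rewrite openE => p [Wp].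
move=> /existsNP[ks /existsNP[c /eqP nz]].
have cF : {for p, continuous (iter_partial ks F c)}.
  by apply: (C1_continuous ((iter_partial_solution ks oW Fs).1 c));
    exact: open_nbhs_in.
have nz0 : 0 < `|iter_partial ks F c p| by rewrite normr_gt0.
have /continuous_ballP/(_ _ nz0)[d d0 H] := cF.
have [d' d'0 dW] := open_ball_in oW Wp.
apply/nbhs_ballP; exists (Num.min d d'); first by rewrite /= lt_min d0.
move=> y py; split.
  by apply: dW; apply: le_ball py; rewrite ge_min lexx orbT.
move=> /(_ ks c) Fy.
have := H y _; rewrite Fy sub0r normrN ltxx; move=> /(_ (le_ball _ py)).
by rewrite ge_min lexx => /(_ isT).
Qed.

(** Uniqueness in the Cauchy problem. Assume that an iterated derivative G vanishes on
    P. Its derivatives along P vanish, and the system, multiplied by b k0 to invert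
    a k0, expresses the remaining derivative through them. When P is open, any k0
    may be chosen. *)
Lemma flat_of_hyperplane W F k0 (P : set X) : open W -> dirac_solution a W F ->
  P `<=` W -> (forall x k, P x -> k != k0 ->
     exists2 d, 0 < d & forall t, `|t| < d -> P (x + t *: axis k)) ->
  (forall x c, P x -> F c x = 0) -> P `<=` flat F.
Proof.
move=> oW Fs PW Pk P0 x Px ks c.
suff H : forall x c, P x -> iter_partial ks F c x = 0 by exact: H.
move=> {x c Px}; elim: ks => [|k ks IH] x c Px /=; first exact: P0.
have Gs := iter_partial_solution ks oW Fs; set G := iter_partial ks F in IH Gs *.
have tangential m c' : m != k0 -> partial m (G c') x = 0.
  move=> mk; have [d d0 Pd] := Pk x m Px mk.
  have D := derivableP (Gs.1 c' m x (PW x Px)).1.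
  apply/eqP; rewrite -normr_le0; apply/ler_addgt0Pr => e e0; rewrite add0r.
  have [d' d'0 H] := is_derive_increment_bound D e0.
  pose q := Num.min d d'; have q0 : 0 < q by rewrite lt_min d0.
  pose t := q / 2; have t0 : 0 < t by rewrite divr_gt0.
  have tq : t < q by rewrite /t; lra.
  have [td td'] : t < d /\ t < d' by move: tq; rewrite lt_min => /andP[].
  have nt : `|t| = t by rewrite ger0_norm// ltW.
  have := H t; rewrite nt => /(_ td').
  rewrite (IH _ _ Px) IH; last by apply: Pd; rewrite nt.
  by rewrite subrr sub0r normrN normrM nt mulrC ler_pM2r.
have [->|] := eqVneq k k0; last exact: tangential.
pose D k : 'cV[R]_N := \col_c partial k (G c) x.
have E : \sum_k a k *m D k = 0.
  apply/colP => c'; rewrite summxE [RHS]mxE -[RHS](Gs.2 x c' (PW x Px)).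
  apply: eq_bigr => m _; rewrite mxE; apply: eq_bigr => c'' _.
  by rewrite [D _ _ _]mxE.
have D0 m : m != k0 -> D m = 0.
  by move=> mk; apply/colP => c'; rewrite [LHS]mxE [RHS]mxE tangential.
have {E} : b k0 *m (a k0 *m D k0) = 0.
  move: E; rewrite (bigD1 k0)//= big1 ?addr0 => [->|m mk]; first by rewrite mulmx0.
  by rewrite D0// mulmx0.
have ba : b k0 *m a k0 = 1%:M.
  have := clifford k0 k0; rewrite eqxx -mulr2n -scaler_nat => H.
  have two0 : (2 : R) != 0 by rewrite pnatr_eq0.
  by apply: (scalerI two0); rewrite H scale_scalar_mx mulr1.
rewrite mulmxA ba mul1mx => /colP/(_ c).
by rewrite [LHS]mxE [RHS]mxE.
Qed.

End Flatness.

(** * Sets of zero Hausdorff measure *)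

Section HausdorffNull.
Context {R : realType} {T : Type} (d : T -> T -> R) (s : R).
Hypothesis s0 : 0 < s.
Local Open Scope ereal_scope.
Implicit Types (U S : set T).

Let cost U : \bar R := diameter d U `^ s.

Lemma diameter_ge0 U : 0 <= diameter d U.
Proof. by rewrite /diameter le_max lexx. Qed.

Let cost_ge0 U : 0 <= cost U.
Proof. exact: poweR_ge0. Qed.

Lemma diameter_le U (D : R) : (0 <= D)%R ->
  (forall x y, U x -> U y -> d x y <= D)%R -> diameter d U <= D%:E.
Proof.
move=> D0 H; rewrite /diameter ge_max lee_fin D0/=.
by apply: ge_ereal_sup => _ [x [y [Ux Uy ->]]]; rewrite lee_fin H.
Qed.

Let cost_set0 : cost set0 = 0.
Proof.
rewrite /cost (_ : diameter d set0 = 0) ?poweR0r ?gt_eqF//.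
by apply/eqP; rewrite eq_le diameter_ge0 andbT diameter_le.
Qed.

Definition hausdorff_null S := forall e : R, (0 < e)%R ->
  exists U : nat -> set T, S `<=` \bigcup_n U n /\
    \sum_(0 <= n <oo) diameter d (U n) `^ s <= e%:E.

Lemma hausdorff_null_subset S S' : S `<=` S' -> hausdorff_null S' -> hausdorff_null S.
Proof.
by move=> SS H e /H[U [SU le]]; exists U; split => //; exact: subset_trans SU.
Qed.

Lemma cost_le_diameter U (D : R) : (0 <= D)%R -> cost U <= (D `^ s)%:E ->
  diameter d U <= D%:E.
Proof.
move=> D0; rewrite leNgt => H; rewrite leNgt; apply/negP => DU; move/negP: H; apply.
rewrite -poweR_EFin /cost.
have := diameter_ge0 U; case: (diameter d U) DU => [r| |]//.
  rewrite lte_fin lee_fin => Dr r0; rewrite !poweR_EFin lte_fin.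
  by apply: gt0_ltr_powR; rewrite ?nnegrE.
by move=> _ _; rewrite poweRyr ?gt_eqF// poweR_EFin ltry.
Qed.

(** A cover of small total cost consists of sets of small diameter, so the bound on
    the diameters in the definition of the measure holds automatically. *)
Lemma hausdorff_null_measure S : hausdorff_null S -> hausdorff_measure d s S = 0.
Proof.
move=> H; apply/eqP; rewrite eq_le; apply/andP; split; last first.
  apply: ereal_sup_ge; exists (hausdorff_premeasure d s 1%R S);
    first by exists 1%R => /=.
  apply: le_ereal_inf_tmp => _ [U [_ _ ->]].
  by apply: nneseries_ge0 => n _ _; exact: poweR_ge0.
apply: ge_ereal_sup => _ [delta /= d0 <-].
apply/lee_addgt0Pr => e e0; rewrite add0e.
pose m := Num.min e (delta `^ s)%R.
have m0 : (0 < m)%R by rewrite lt_min e0 powR_gt0.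
have [U [SU Ule]] := H m m0.
apply: (@le_trans _ _ (\sum_(0 <= n <oo) cost (U n))); last first.
  by apply: (le_trans Ule); rewrite lee_fin ge_min lexx.
apply: ereal_inf_lbound; exists U; split => // n.
apply: cost_le_diameter; first exact: ltW.
apply: (@le_trans _ _ m%:E); last by rewrite lee_fin ge_min lexx orbT.
apply: le_trans Ule.
have := @nneseries_lim_ge _ (cost \o U) xpredT 0%N n.+1 (fun n _ _ => cost_ge0 (U n)).
apply: le_trans; rewrite big_nat_recr//= leeDr//.
by apply: sume_ge0 => i _; exact: cost_ge0.
Qed.

(** Pads with empty sets, which cost nothing, so that covers may be indexed by any
    countable type. *)
Lemma countable_cover (I : countType) (U : I -> set T) :
  exists V : nat -> set T, \bigcup_i U i `<=` \bigcup_n V n /\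
    \sum_(0 <= n <oo) cost (V n) = \esum_(i in setT) cost (U i).
Proof.
pose V n := if pickle_inv n is Some i then U i else set0.
exists V; split.
  by move=> x [i _ Ux]; exists (pickle i) => //; rewrite /V pickleK_inv.
rewrite nneseries_esumT//.
have -> : \esum_(n in [set: nat]) cost (V n) = \esum_(n in pickle @` [set: I]) cost
  (V n).
  rewrite [RHS]esum_mkcond; apply: eq_esum => n _; case: ifPn => // nI.
  rewrite /V; case E : (pickle_inv n) => [i|//].
  exfalso; move/negP: nI; apply; rewrite inE; exists i => //.
  by have := @pickle_invK I n; rewrite E.
rewrite esum_image; last by move=> i j _ _; exact: (pcan_inj (@pickleK _)).
by apply: eq_esum => i _; rewrite /V pickleK_inv.
Qed.

(** The piece of rank i is covered at the cost e / 2^(i + 1). *)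
Lemma hausdorff_null_bigcup (I : countType) (S : I -> set T) :
  (forall i, hausdorff_null (S i)) -> hausdorff_null (\bigcup_i S i).
Proof.
move=> H e e0.
have /choice[U HU] : forall i, exists U : nat -> set T, S i `<=` \bigcup_n U n /\
    \sum_(0 <= n <oo) cost (U n) <= (e / (2 ^ (pickle i).+1)%:R)%:E.
  by move=> i; apply: H; rewrite divr_gt0// ltr0n expn_gt0.
have [V [UV VE]] := countable_cover (fun k : I * nat => U k.1 k.2).
exists V; split.
  apply: subset_trans UV => x [i _ /(HU i).1[n _ Ux]]; by exists (i, n).
rewrite VE.
have -> : \esum_(k in [set: I * nat]) cost (U k.1 k.2) =
    \esum_(i in [set: I]) \esum_(n in [set: nat]) cost (U i n).
  rewrite esum_esum//; congr (esum _ _); apply/seteqP; split => //.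
apply: (@le_trans _ _ (\esum_(i in [set: I]) (e / (2 ^ (pickle i).+1)%:R)%:E)).
  by apply: le_esum => i _; rewrite -nneseries_esumT//; exact: (HU i).2.
rewrite -(esum_image setT pickle (fun n => (e / (2 ^ n.+1)%:R)%:E)); last first.
  by move=> i j _ _; exact: (pcan_inj (@pickleK _)).
have g0 n : 0 <= (e / (2 ^ n.+1)%:R)%:E by rewrite lee_fin divr_ge0// ltW.
apply: (@le_trans _ _ (\esum_(n in [set: nat]) (e / (2 ^ n.+1)%:R)%:E)).
  by rewrite esum_mkcond; apply: le_esum => n _; case: ifP.
by rewrite -nneseries_esumT//; exact: epsilon_trick0 (ltW e0).
Qed.

Lemma hausdorff_null_finite S : (forall e : R, (0 < e)%R ->
    exists (I : finType) (U : I -> set T) (D : R),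
      [/\ (0 <= D)%R, S `<=` \bigcup_i U i, forall i, (diameter d (U i) <= D%:E)%E
        & #|I|%:R * D `^ s <= e]%R) ->
  hausdorff_null S.
Proof.
move=> H e /H[I [U [D [D0 SU UD le]]]].
have [V [UV VE]] := countable_cover U.
exists V; split; first exact: subset_trans UV.
rewrite VE.
have finI : finite_set [set: I] by exact: finite_finset.
rewrite esum_fset// fsbig_finite//=.
have cD i : cost (U i) <= (D `^ s)%:E.
  rewrite -poweR_EFin; apply: gt0_ler_poweR => //; first exact: ltW.
  - by rewrite in_itv/= diameter_ge0 leey.
  - by rewrite in_itv/= lee_fin D0 leey.
set r := finmap.enum_fset _.
have bound (q : seq I) : (\sum_(x <- q) cost (U x))%R <= ((size q)%:R * D `^ s)%:E.
  elim: q => [|i q IH]; first by rewrite big_nil mul0r.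
  by rewrite big_cons /= -natr1 mulrDl mul1r addrC EFinD leeD.
apply: (le_trans (bound r)); rewrite lee_fin.
apply: le_trans le; rewrite ler_wpM2r ?powR_ge0// ler_nat.
by rewrite -(card_uniqP (finmap.fset_uniq _)) max_card.
Qed.

End HausdorffNull.

Lemma hausdorff_dim_le {R : realType} {T : Type} (d : T -> T ->
  R) (S : set T) (t : R) :
  0 <= t -> (forall s, t < s -> hausdorff_null d s S) ->
    (hausdorff_dim d S <= t%:E)%E.
Proof.
move=> t0 H; apply/lee_addgt0Pr => e e0.
have te : t < t + e by rewrite ltrDl.
apply: ereal_inf_lbound; exists (t + e) => //; split; first exact: le_lt_trans te.
by apply: hausdorff_null_measure; [exact: le_lt_trans te|exact: H].
Qed.

(** * Zero sets of differentiable functions *)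

Section ZeroSets.
Context {R : realType} {n : nat} {T : Type} (d : T -> T -> R).
Local Notation X := 'rV[R]_n.+1.
Variables (e : X -> T) (L : R).
Hypothesis eL : forall x y, d (e x) (e y) <= L * \sum_i `|x 0 i - y 0 i|.
Implicit Types (u : X -> R) (x y z p : X) (k : 'I_n.+1) (r : R) (W : set X).

(** Change y into z by moving in the coordinates other than k, then along the axis k.
    The first move changes u by at most B times its length, the second by at least A
    times its length, and the total change is 0. *)
Lemma zero_set_transversal u p r k (A B : R) : 0 < A ->
  (forall i x, ball p r x -> derivable u x (axis i) /\ `|partial i u x| <= B) ->
  (forall x, ball p r x -> A <= `|partial k u x|) ->
  forall y z, ball p r y -> ball p r z -> u y = 0 -> u z = 0 ->
    `|y 0 k - z 0 k| <= B / A * \sum_(i | i != k) `|y 0 i - z 0 i|.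
Proof.
move=> A0 uB uA y z py pz uy uz.
have /ball_rVP[r0 py'] := py; have /ball_rVP[_ pz'] := pz.
pose w := z + (y 0 k - z 0 k) *: axis k.
have seg (a : R) : 0 <= a <= 1 -> ball p r (z + (a * (y 0 k - z 0 k)) *: axis k).
  move=> a01; apply/ball_rVP; split => // i; rewrite !mxE eqxx/=.
  have [->|ik] := eqVneq i k; last by rewrite mulr0 addr0.
  rewrite mulr1.
  have -> : p 0 k - (z 0 k + a * (y 0 k - z 0 k)) =
     (1 - a) * (p 0 k - z 0 k) + a * (p 0 k - y 0 k) by ring.
  exact: ltr_norm_conv.
have pw : ball p r w by have := seg 1; rewrite mul1r; apply; apply/andP; split; lra.
have h1 := lipschitz_box (fun i x => uB i x) py pw.
have [a a01 E] := mvt_line (fun a a01 => (uB k _ (seg a a01)).1).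
rewrite -/w uz subr0 in E; rewrite uy subr0 E in h1.
have sumE : \sum_i `|w 0 i - y 0 i| = \sum_(i | i != k) `|y 0 i - z 0 i|.
  have wE i : w 0 i = z 0 i + (if i == k then y 0 k - z 0 k else 0).
    by rewrite /w !mxE eqxx/=; case: eqP => _; rewrite ?mulr1 ?mulr0.
  rewrite (bigD1 k)//= wE eqxx addrCA subrr addr0 subrr normr0 add0r.
  by apply: eq_bigr => i ik; rewrite wE (negbTE ik) addr0 distrC.
rewrite sumE normrM in h1.
rewrite mulrAC ler_pdivlMr// mulrC; apply: le_trans h1.
by rewrite ler_wpM2r//; apply: uA; exact: seg.
Qed.

(** By [zero_set_transversal] the zero set is a Lipschitz graph over n coordinates.
    Cutting each of them into m intervals gives m^n pieces of diameter at most C / m,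
    and m^n (C / m)^s is small for m large. *)
Lemma local_zero_set_null u p r k (A B s : R) : 0 < A -> 0 < r -> 0 <= L ->
  n%:R < s ->
  (forall i x, ball p r x -> derivable u x (axis i) /\ `|partial i u x| <= B) ->
  (forall x, ball p r x -> A <= `|partial k u x|) ->
  hausdorff_null d s (e @` [set x | ball p r x /\ u x = 0]).
Proof.
move=> A0 r0 L0 ns uB uA.
have s0 : 0 < s by apply: le_lt_trans ns.
have B0 : 0 <= B.
  by apply: le_trans (uB k p (ballxx _ r0)).2.
pose C := L * ((1 + B / A) * (n%:R * (2 * r))).
have C0 : 0 <= C.
  apply: mulr_ge0 => //; apply: mulr_ge0; last by rewrite mulr_ge0// mulr_ge0// ltW.
  by rewrite addr_ge0// divr_ge0// ltW.
apply: hausdorff_null_finite => // eps eps0.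
have sn0 : 0 < s - n%:R by rewrite subr_gt0.
(* K ^ (s - n) = C ^ s / eps, so m >= K gives m ^ n * (C / m) ^ s <= eps. *)
pose K := (C `^ s / eps) `^ (s - n%:R)^-1.
pose m := (Num.truncn K).+1.
have m0 : 0 < m%:R :> R by [].
have Km : K <= m%:R.
  by have /andP[_ /ltW] := truncn_itv (powR_ge0 (C `^ s / eps) (s - n%:R)^-1).
pose q (x : X) i : R := (x 0 i - p 0 i + r) / (2 * r).
pose cell (f : {ffun 'I_n -> 'I_m}) : set X := [set x | (ball p r x /\ u x = 0) /\
   forall i, Num.truncn (q x (lift k i) * m%:R) = f i].
have r20 : 0 < 2 * r by rewrite mulr_gt0.
have q01 x i : ball p r x -> 0 <= q x i * m%:R < m%:R.
  move=> /ball_rVP[_ /(_ i)]; rewrite ltr_norml => /andP[h1 h2].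
  rewrite mulr_ge0 ?divr_ge0//=; [|lra..].
  rewrite gtr_pMl// ltr_pdivrMr// mul1r; lra.
exists {ffun 'I_n -> 'I_m}, (fun f => e @` cell f), (C / m%:R); split.
- by rewrite divr_ge0.
- move=> _ [x [px ux] <-].
  have lt i : (Num.truncn (q x (lift k i) * m%:R) < m)%N.
    by have /andP[h1 h2] := q01 x (lift k i) px; rewrite truncn_lt_nat.
  exists [ffun i => Ordinal (lt i)] => //; exists x => //.
  by split => // i; rewrite ffunE.
- move=> f; apply: diameter_le; first by rewrite divr_ge0.
  move=> _ _ [y [[py uy] fy] <-] [z [[pz uz] fz] <-].
  apply: (le_trans (eL y z)); rewrite /C -mulrA ler_wpM2l//.
  have yz i : `|y 0 (lift k i) - z 0 (lift k i)| <= 2 * r / m%:R.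
    have /andP[/truncn_itv + _] := q01 y (lift k i) py.
    have /andP[/truncn_itv + _] := q01 z (lift k i) pz.
    rewrite fy fz => /andP[a1 a2] /andP[b1 b2].
    rewrite ler_pdivlMr//.
    have -> : `|y 0 (lift k i) - z 0 (lift k i)| * m%:R =
        (2 * r) * `|q y (lift k i) * m%:R - q z (lift k i) * m%:R|.
      have -> : q y (lift k i) * m%:R - q z (lift k i) * m%:R =
          (y 0 (lift k i) - z 0 (lift k i)) * (m%:R / (2 * r)) by rewrite /q; ring.
      rewrite normrM (gtr0_norm (divr_gt0 m0 r20)) mulrCA; congr (_ * _).
      by rewrite mulrCA divff ?mulr1// gt_eqF.
    rewrite -[leRHS]mulr1 ler_pM2l// ler_norml; rewrite -natr1 in a2 b2.
    by apply/andP; split; lra.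
  have sumk : \sum_(i | i != k) `|y 0 i - z 0 i| <= n%:R * (2 * r / m%:R).
    have -> : \sum_(i | i != k) `|y 0 i - z 0 i| =
        \sum_i `|y 0 (lift k i) - z 0 (lift k i)|.
      apply: (addrI `|y 0 k - z 0 k|).
      transitivity (\sum_i `|y 0 i - z 0 i|); first by rewrite [RHS](bigD1 k).
      by rewrite [LHS](bigD1_ord k).
    apply: (@le_trans _ _ (\sum_(i < n) (2 * r / m%:R))).
      by apply: ler_sum => i _; exact: yz.
    by rewrite sumr_const card_ord -[leLHS]mulr_natl.
  rewrite (bigD1 k)//=.
  have := zero_set_transversal A0 uB uA py pz uy uz.
  have BA0 : 0 <= B / A by rewrite divr_ge0// ltW.
  set S := \sum_(i | i != k) _ in sumk *; move=> tr.
  have -> : (1 + B / A) * (n%:R * (2 * r)) / m%:R =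
     B / A * (n%:R * (2 * r / m%:R)) + n%:R * (2 * r / m%:R) by ring.
  by rewrite lerD// (le_trans tr)// ler_wpM2l.
rewrite card_ffun !card_ord natrX.
have -> : (C / m%:R) `^ s = C `^ s / (m%:R `^ s) :> R.
  by rewrite powRM ?invr_ge0// -powR_inv1// -powRrM mulN1r powRN.
have -> : m%:R `^ s = m%:R ^+ n * m%:R `^ (s - n%:R) :> R.
  rewrite -powR_mulrn// -powRD; first by congr (_ `^ _); ring.
  by apply/implyP => _; rewrite gt_eqF.
rewrite invfM mulrCA mulVKf ?expf_neq0 ?gt_eqF//.
rewrite ler_pdivrMr ?powR_gt0// mulrC -ler_pdivrMr//.
have -> : C `^ s / eps = K `^ (s - n%:R).
  rewrite /K -powRrM mulVf ?gt_eqF// powRr1//.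
  by rewrite divr_ge0 ?powR_ge0// (ltW eps0).
by rewrite (ge0_ler_powR (ltW sn0))// nnegrE ?powR_ge0 ?(ltW m0).
Qed.

End ZeroSets.

Section ZeroSetsGlobal.
Context {R : realType} {n : nat} {T : Type} (d : T -> T -> R).
Local Notation X := 'rV[R]_n.+1.
Variables (e : X -> T) (L s : R).
Hypothesis eL : forall x y, d (e x) (e y) <= L * \sum_i `|x 0 i - y 0 i|.
Hypothesis L0 : 0 <= L.
Hypothesis ns : n%:R < s.
Implicit Types (u : X -> R) (x y z p : X) (k : 'I_n.+1) (r : R) (W : set X).

Let s0 : 0 < s. Proof. exact: le_lt_trans ns. Qed.

Definition grid_cell (N : nat) (v : 'rV[int]_n.+1) : set X :=
  [set y | forall i, Num.floor (y 0 i * N.+1%:R) = v 0 i].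

Lemma grid_cell_ball N v x y : grid_cell N v x -> grid_cell N v y ->
  ball x (2 / N.+1%:R) y.
Proof.
move=> Nx Ny; apply/ball_rVP; split; first by rewrite divr_gt0.
move=> i; have N0 : 0 < N.+1%:R :> R by [].
rewrite ltr_pdivlMr// -[X in _ * X](gtr0_norm N0) -normrM mulrBl.
have := floor_itv (x 0 i * N.+1%:R); have := floor_itv (y 0 i * N.+1%:R).
rewrite (Nx i) (Ny i) intrD => /andP[? ?] /andP[? ?].
rewrite ltr_norml; apply/andP; split; lra.
Qed.

(** The grid cells of all scales form a countable family, and every point lies in a
    cell contained in any given ball around it. *)
Lemma hausdorff_null_local (Z : set X) :
  (forall x, Z x -> exists2 r, 0 < r & hausdorff_null d s (e @` (Z `&` ball x r))) ->
  hausdorff_null d s (e @` Z).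
Proof.
move=> HZ.
pose S (i : nat * 'rV[int]_n.+1) : set T :=
  [set y | hausdorff_null d s (e @` (Z `&` grid_cell i.1 i.2)) /\
    (e @` (Z `&` grid_cell i.1 i.2)) y].
have nS i : hausdorff_null d s (S i).
  have [H|H] := pselect (hausdorff_null d s (e @` (Z `&` grid_cell i.1 i.2))).
    by apply: hausdorff_null_subset H => y [].
  move=> eps eps0; exists (fun=> set0); split; first by move=> y [/H].
  rewrite eseries0 ?lee_fin ?ltW// => i0 _ _.
  rewrite (_ : diameter d set0 = 0%E) ?poweR0r ?gt_eqF//.
  by apply/eqP; rewrite eq_le diameter_ge0 andbT diameter_le.
apply: hausdorff_null_subset (hausdorff_null_bigcup s0 nS) => _ [x Zx <-].
have [r r0 Hr] := HZ x Zx.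
pose N := Num.truncn (2 / r); pose v : 'rV[int]_n.+1 :=
  \row_i Num.floor (x 0 i * N.+1%:R).
have Nr : 2 / N.+1%:R < r.
  rewrite ltr_pdivrMr// mulrC -ltr_pdivrMr//.
  by have /andP[] := @truncn_itv R (2 / r) (divr_ge0 (ler0n _ 2) (ltW r0)).
have xv : grid_cell N v x by move=> i; rewrite mxE.
exists (N, v) => //; split; last by exists x.
apply: hausdorff_null_subset Hr => _ [y [Zy yv] <-]; exists y => //; split => //.
exact: le_ball (ltW Nr) _ (grid_cell_ball xv yv).
Qed.

Lemma zero_set_null W u k : open W -> C1_partials W u ->
  hausdorff_null d s (e @` [set x | [/\ W x, u x = 0 & partial k u x != 0]]).
Proof.
move=> oW C1; apply: hausdorff_null_local => x [Wx ux kx].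
have [B HB] := C1_partial_bounded C1 (open_nbhs_in oW Wx).
pose A := `|partial k u x| / 2.
have A0 : 0 < A by rewrite divr_gt0// normr_gt0.
have /continuous_ballP/(_ _ A0)[d1 d10 H1] := (C1 k x Wx).2.
have /nbhs_ballP[r0 /= r00 Br] := HB.
have [d2 d20 H2] := open_ball_in oW Wx.
pose r := Num.min r0 (Num.min d1 d2); have rp : 0 < r by rewrite !lt_min r00 d10.
have br y : ball x r y -> [/\ W y, forall i, `|partial i u y| <= B &
  A <= `|partial k u y|].
  move=> xy; split.
  - by apply: H2; apply: le_ball xy; rewrite /r !ge_min lexx !orbT.
  - by apply: Br; apply: le_ball xy; rewrite /r !ge_min lexx.
  - have := H1 y (le_ball _ xy); rewrite /r !ge_min lexx !orbT => /(_ isT) H.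
    have := ler_dist_dist (partial k u y) (partial k u x).
    have := lerB_normD (partial k u x) (partial k u y - partial k u x).
    rewrite addrCA subrr addr0 /A in H * => h _; lra.
exists r => //.
have uB i y : ball x r y -> derivable u y (axis i) /\ `|partial i u y| <= B.
  by move=> /br[Wy HBy _]; split => //; exact: (C1 i y Wy).1.
have uA y : ball x r y -> A <= `|partial k u y| by move=> /br[].
apply: hausdorff_null_subset (local_zero_set_null eL A0 rp L0 ns uB uA).
by move=> _ [y [[_ uy _] xy] <-]; exists y.
Qed.

Variables (M : nat) (a b : 'I_n.+1 -> 'M[R]_M).
Hypothesis clifford : forall k l,
  b k *m a l + b l *m a k = (if k == l then 2 else 0)%:M.

(** At a zero that is not flat, a shortest iterated derivative that does not vanish is
    a partial derivative of one that vanishes. The point is then a regular zero of the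
    latter, which leaves countably many cases for [zero_set_null]. *)
Lemma not_flat_zero_set_null W F (P : set X) : open W -> dirac_solution a W F ->
  P `<=` W `\` flat F -> (forall x c, P x -> F c x = 0) ->
    hausdorff_null d s (e @` P).
Proof.
move=> oW Fs PW P0.
pose S (i : seq 'I_n.+1 * 'I_n.+1 * 'I_M) : set T := e @`
  [set x | [/\ W x, iter_partial i.1.1 F i.2 x = 0 &
    partial i.1.2 (iter_partial i.1.1 F i.2) x != 0]].
have nS i : hausdorff_null d s (S i).
  by apply: zero_set_null => //; exact: (iter_partial_solution clifford i.1.1 oW
    Fs).1.
apply: hausdorff_null_subset (hausdorff_null_bigcup s0 nS) => _ [x Px <-].
have [Wx /existsNP[ks /existsNP[c /eqP nz]]] := PW x Px.
suff [ls [k [c' [z nz']]]] : exists ls k c',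
  iter_partial ls F c' x = 0 /\ iter_partial (k :: ls) F c' x != 0.
  by exists (ls, k, c') => //; exists x.
elim: ks nz => [|k ks IH] nz; first by rewrite /= P0 ?eqxx in nz.
have [z|nz'] := eqVneq (iter_partial ks F c x) 0; first by exists ks, k, c.
exact: IH.
Qed.

End ZeroSetsGlobal.

(** * Quaternions and coordinates on a slice *)

Lemma sum3 (V : nmodType) (F : 'I_3 -> V) : \sum_i F i = F 0 + F 1 + F 2.
Proof.
rewrite !big_ord_recl big_ord0 addr0 addrA.
by congr (F _ + F _ + F _); exact: val_inj.
Qed.

Lemma sum4 (V : nmodType) (F : 'I_4 -> V) : \sum_i F i = F 0 + F 1 + F 2 + F 3.
Proof.
rewrite !big_ord_recl big_ord0 addr0 !addrA.
by congr (F _ + F _ + F _ + F _); exact: val_inj.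
Qed.

Lemma ord3P (k : 'I_3) : [\/ k = 0, k = 1 | k = 2].
Proof.
by case: k => [[|[|[|//]]] ?]; [constructor 1|constructor 2|constructor 3];
  exact: val_inj.
Qed.

Lemma ord4P (k : 'I_4) : [\/ k = 0, k = 1, k = 2 | k = 3].
Proof.
by case: k => [[|[|[|[|//]]]] ?];
  [constructor 1|constructor 2|constructor 3|constructor 4]; exact: val_inj.
Qed.

Section LeftMultiplication.
Context {R : realType}.
Local Notation H := (quaternion R).
Implicit Types p q : H.

Definition lmul_mx p : 'M[R]_4 :=
  \matrix_(i, j) (p * (delta_mx 0 j : 'rV[R]_4) : H) 0 i.

Lemma lmul_mx_entry p i j : lmul_mx p i j = (p * (delta_mx 0 j : 'rV[R]_4) : H) 0 i.
Proof. by rewrite [LHS]mxE. Qed.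

Lemma lmul_mxE p q i : (p * q) 0 i = \sum_j lmul_mx p i j * q 0 j.
Proof.
rewrite sum4 !lmul_mx_entry !qME.
by have [->|->|->|->] := ord4P i; rewrite /qmul !mkqE !mxE !eqxx /=; ring.
Qed.

Lemma lmul_mxM p q : lmul_mx p *m lmul_mx q = lmul_mx (p * q).
Proof.
apply/matrixP => i j; rewrite [LHS]mxE [RHS]lmul_mx_entry -mulrA [RHS]lmul_mxE.
by apply: eq_bigr => k _; rewrite [lmul_mx q _ _]lmul_mx_entry.
Qed.

Lemma lmul_mxD p q : lmul_mx p + lmul_mx q = lmul_mx (p + q).
Proof. by apply/matrixP => i j; rewrite [LHS]mxE !lmul_mx_entry mulrDl qDE. Qed.

Lemma lmul_mx_scalar (r : R) : lmul_mx (r%:A) = r%:M.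
Proof.
apply/matrixP => i j; rewrite lmul_mx_entry -scalerAl mul1r.
by rewrite !mxE eqxx/= mulr_natr.
Qed.

End LeftMultiplication.

Section SliceCoordinates.
Context {R : realType}.
Local Notation H := (quaternion R).
Local Notation X := 'rV[R]_3.
Variables (b c : R).
Hypothesis bc1 : b ^+ 2 + c ^+ 2 = 1.

Definition unit_imag : H := b *: qj + c *: qk.
Local Notation J := unit_imag.

Definition frame (k : 'I_3) : H := [:: 1; qi; J]`_k.
(** The quaternion conjugates of the units of [frame]. *)
Definition coframe (k : 'I_3) : H := [:: 1; - qi; - J]`_k.

(** qi and J are anticommuting square roots of -1. *)
Lemma frame_clifford k l : coframe k * frame l + coframe l * frame k =
  (if k == l then 2 else 0)%:A.
Proof.
have B : b ^+ 2 = 1 - c ^+ 2 by rewrite -bc1 addrK.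
by have [->|->|->] := ord3P k; have [->|->|->] := ord3P l;
  apply: quaternionP; rewrite /coframe /frame /= /unit_imag /qi /qj /qk ?q1E
   !(qDE, qME, qNE, qZE) /qmul !(qNE, qDE, qZE, mkqE); ring: B.
Qed.

Lemma lmul_clifford k l :
  lmul_mx (coframe k) *m lmul_mx (frame l) +
    lmul_mx (coframe l) *m lmul_mx (frame k) =
  (if k == l then 2 else 0)%:M.
Proof. by rewrite !lmul_mxM lmul_mxD frame_clifford lmul_mx_scalar. Qed.

Definition embed (x : X) : H := (x 0 0)%:A + x 0 1 *: qi + x 0 2 *: J.
(** Orthogonal projection onto the slice space, in coordinates: a continuous left
    inverse of [embed] defined on all quaternions. *)
Definition coords (q : H) : X :=
  \row_k [:: q 0 0; q 0 1; b * q 0 2 + c * q 0 3]`_k.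

Lemma embedE x : (embed x 0 0 = x 0 0) * (embed x 0 1 = x 0 1) *
  (embed x 0 2 = x 0 2 * b) * (embed x 0 3 = x 0 2 * c).
Proof.
by rewrite /embed /unit_imag /qi /qj /qk !(qDE, qZE) q1E !mkqE; do !split; ring.
Qed.

Lemma embedK x : coords (embed x) = x.
Proof.
apply/rowP => k; rewrite mxE !embedE.
have [->|->|->] := ord3P k => //=.
by rewrite -[RHS]mulr1 -bc1; ring.
Qed.

Lemma slice_spaceP q : slice_space J q <-> embed (coords q) = q.
Proof.
split=> [[x0 [x1 [x2 ->]]]|<-].
  pose x : X := \row_k [:: x0; x1; x2]`_k.
  rewrite (_ : _ + _ = embed x); first by rewrite embedK.
  by rewrite /embed !mxE.
by exists (coords q 0 0), (coords q 0 1), (coords q 0 2).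
Qed.

Lemma embed_slice x : slice_space J (embed x).
Proof. by exists (x 0 0), (x 0 1), (x 0 2). Qed.

Lemma embed_line x k (h : R) : embed (h *: axis k + x) = h *: frame k + embed x.
Proof.
have E i : (h *: axis k + x) 0 i = h * (i == k)%:R + x 0 i by rewrite !mxE eqxx.
by apply: quaternionP; rewrite !(qDE, qZE, embedE) !E;
  have [->|->|->] := ord3P k; rewrite /frame /= /unit_imag /qi /qj /qk ?q1E
   !(qDE, qZE, mkqE) ?eqxx /=; ring.
Qed.

Lemma embedB x y : embed x - embed y = embed (x - y).
Proof.
by apply: quaternionP; rewrite !(qDE, qNE, embedE) !mxE; ring.
Qed.

(** The units 1, qi and J are orthonormal. *)
Lemma embed_lipschitz x y : qdist (embed x) (embed y) <= 1 * \sum_i `|x 0 i - y 0 i|.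
Proof.
rewrite mul1r /qdist /qnorm embedB sum4 !embedE sum3 !mxE.
set A := x 0 0 - y 0 0; set B := x 0 1 - y 0 1; set C := x 0 2 - y 0 2.
have -> : A ^+ 2 + B ^+ 2 + (C * b) ^+ 2 + (C * c) ^+ 2 = `|A| ^+ 2 + `|B| ^+ 2 +
  `|C| ^+ 2.
  by rewrite !real_normK ?num_real// -[X in _ = _ + X]mulr1 -bc1; ring.
have a0 := normr_ge0 A; have b0 := normr_ge0 B; have c0 := normr_ge0 C.
set S := `|A| + `|B| + `|C|.
have S0 : 0 <= S by rewrite !addr_ge0.
have <- : Num.sqrt (S ^+ 2) = S by rewrite sqrtr_sqr ger0_norm.
rewrite /S; apply: ler_wsqrtr; nra.
Qed.

Lemma embed_continuous : continuous (embed : X -> H).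
Proof.
move=> x; have cx i : {for x, continuous (fun y : X => y 0 i)}
  by exact: coord_continuous.
have cZ i (v : H) : {for x, continuous (fun y : X => y 0 i *: v)}.
  exact: (continuous_comp (cx i) (@scalel_continuous R H v _)).
exact: (continuousD (continuousD (cZ 0 1) (cZ 1 qi)) (cZ 2 J)).
Qed.

Lemma coords_continuous : continuous (coords : H -> X).
Proof.
move=> q.
have cq i : {for q, continuous (fun p : H => p 0 i : R)}
  by exact: (@coord_continuous R 1 4).
have ck (k : 'I_3) : {for q, continuous (fun p : H => coords p 0 k)}.
  have -> : (fun p : H => coords p 0 k) =
      (fun p : H => [:: p 0 0; p 0 1; b * p 0 2 + c * p 0 3]`_k).
    by apply/funext => p; rewrite mxE.
  have cc (t : R) : {for q, continuous (fun=> t : R)} by exact: cst_continuous.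
  have [->|->|->] := ord3P k => /=; [exact: cq|exact: cq|].
  exact: (continuousD (continuousM (cc b) (cq 2)) (continuousM (cc c) (cq 3))).
move=> A [B HB BA].
have HBk k : nbhs q [set p | B 0 k (coords p 0 k)] by exact: (ck k _ (HB 0 k)).
have HBall := @filter_forall _ _ (fun k p => B 0 k (coords p 0 k)) _ _ HBk.
suff : nbhs q [set p | A (coords p)] by [].
have /nbhs_ballP[r /= r0 Hr] : nbhs q [set p | forall k, B 0 k (coords p 0 k)]
  by exact: HBall.
apply/nbhs_ballP; exists r => // p /Hr Hp.
by apply: BA => i k; rewrite (ord1 i); exact: Hp.
Qed.

Section Pullback.
Variables (Omega : set H) (f : H -> H).
Hypothesis oOmega : open Omega.
Hypothesis fJ : monogenic J (slice Omega J) f.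

Definition slice_domain : set X := [set x | Omega (embed x)].
Definition component (m : 'I_4) : X -> R := fun x => f (embed x) 0 m.

Lemma open_slice_domain : open slice_domain.
Proof. by move: oOmega; apply: open_comp => x _; exact: embed_continuous. Qed.

Lemma slice_domain_slice x : slice_domain x -> slice Omega J (embed x).
Proof. by move=> Ox; split => //; exact: embed_slice. Qed.

Lemma frame_mem k : frame k \in [:: 1; qi; J].
Proof. by have [->|->|->] := ord3P k; rewrite /frame /= !inE eqxx ?orbT. Qed.

(** [embed] carries the lines parallel to the axis k to
    the lines directed by frame k. *)
Lemma is_derive_component m k x : slice_domain x ->
  is_derive x (axis k) (component m) (('D_(frame k) f (embed x)) 0 m).
Proof.
move=> /slice_domain_slice Sx.
have [df _] := fJ.1 _ (frame_mem k).
have := df _ Sx; rewrite /derivable => /cvg_ex[/= l Hl].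
have El : 'D_(frame k) f (embed x) = l by exact: (cvg_lim _ Hl).
rewrite El.
have C : h^-1 *: ((component m \o shift x) (h *: axis k) - component m x) @[h -->
  0^'] --> (l 0 m : R).
  have Q h : h^-1 *: ((component m \o shift x) (h *: axis k) - component m x) =
     (h^-1 *: ((f \o shift (embed x)) (h *: frame k) - f (embed x))) 0 m.
    by rewrite /component /= embed_line !mxE.
  pose quot h : 'rV[R]_4 := h^-1 *: ((f \o shift (embed x)) (h *: frame k)
    - f (embed x)).
  have Hl' : quot h @[h --> 0^'] --> l by exact: Hl.
  rewrite (_ : (fun h => _) = (fun M : 'rV[R]_4 => M 0 m) \o quot); last exact/funext.
  apply: (@cvg_comp _ _ _ quot (fun M : 'rV[R]_4 => M 0 m) _ _ _ Hl').
  exact: (@coord_continuous R 1 4 0 m l).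
by apply: DeriveDef; [apply: cvgP C|exact: cvg_lim C].
Qed.

Lemma component_C1 m : C1_partials slice_domain (component m).
Proof.
move=> k x Ox; split; first by have [] := is_derive_component m k Ox.
have oW := open_slice_domain.
apply: (@continuous_at_eq _ _ slice_domain (fun y =>
  ('D_(frame k) f (embed y)) 0 m) _ x oW Ox).
  by move=> y Oy; rewrite /partial (@derive_val _ _ _ _ _ _ _ (is_derive_component m
    k Oy)).
have [_ cf] := fJ.1 _ (frame_mem k).
have Sx := slice_domain_slice Ox.
have cD : {for x, continuous (fun y => 'D_(frame k) f (embed y))}.
  have /subspace_continuousP := cf; move=> /(_ _ Sx) Hf.
  move=> A /Hf; rewrite nbhs_simpl /= => HA.
  have HB := @embed_continuous x _ HA.
  have /nbhs_ballP[d1 /= d10 H1] :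
    nbhs x [set y | slice Omega J (embed y) -> A ('D_(frame k) f (embed y))]
      by exact: HB.
  have [d2 d20 H2] := open_ball_in oW Ox.
  suff : nbhs x [set y | A ('D_(frame k) f (embed y))] by [].
  apply/nbhs_ballP; exists (Num.min d1 d2) => /=; first by rewrite lt_min d10.
  move=> y xy; apply: H1; first by apply: le_ball xy; rewrite ge_min lexx.
  by apply: slice_domain_slice; apply: H2; apply: le_ball xy;
    rewrite ge_min lexx orbT.
exact: (continuous_comp cD (@coord_continuous R 1 4 0 m _)).
Qed.

Lemma component_solution :
  dirac_solution (fun k => lmul_mx (frame k)) slice_domain component.
Proof.
split; first exact: component_C1.
move=> x m Ox.
have Sx := slice_domain_slice Ox.
transitivity ((\sum_k frame k * 'D_(frame k) f (embed x)) 0 m).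
  rewrite summxE; apply: eq_bigr => k _; rewrite lmul_mxE.
  apply: eq_bigr => j _.
  by rewrite /partial (@derive_val _ _ _ _ _ _ _ (is_derive_component j k Ox)).
rewrite sum3; have := fJ.2 _ Sx.
by rewrite /frame /= mul1r => ->; rewrite mxE.
Qed.

End Pullback.

End SliceCoordinates.

(** * The identity principle *)

Section Difference.
Context {R : realType}.
Local Notation H := (quaternion R).
Local Notation X := 'rV[R]_3.
Variables (Omega : set H) (f g : H -> H).
Hypothesis sdO : slice_domain13 Omega.
Hypothesis rf : regular13 Omega f.
Hypothesis rg : regular13 Omega g.

Let oO : open Omega. Proof. by have [[]] := sdO. Qed.

Section OneSlice.
Variables b c : R.
Hypothesis bc1 : b ^+ 2 + c ^+ 2 = 1.
Local Notation J := (unit_imag b c).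
Local Notation W := (slice_domain b c Omega).
Let clif := lmul_clifford bc1.

Let sJ : sphere1 J. Proof. by exists b, c. Qed.

Definition difference (m : 'I_4) (x : X) : R :=
  1 * component b c f m x + (-1) * component b c g m x.
Local Notation D := difference.

Let oW : open W. Proof. exact: open_slice_domain. Qed.

Lemma difference_solution : dirac_solution (fun k => lmul_mx (frame b c k)) W D.
Proof.
apply: dirac_solution_lincomb => //.
  exact: component_solution oO (rf sJ).
exact: component_solution oO (rg sJ).
Qed.

Lemma difference_eq0 x : (forall m, D m x = 0) <-> f (embed b c x) = g (embed b c x).
Proof.
rewrite /D /component; split => [E|E m]; last by rewrite E mul1r mulN1r subrr.
apply/rowP => m; apply/eqP; rewrite -subr_eq0; have := E m.
by rewrite mul1r mulN1r => /eqP.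
Qed.

(** The flat points are open and closed in the slice, by [open_flat] and
    [open_not_flat]. *)
Lemma slice_eq_of_flat p : W p -> flat D p -> forall q, slice Omega J q -> f q = g q.
Proof.
move=> Wp Fp q Sq.
pose A := slice Omega J.
pose B := [set q : H | A q /\ flat D (coords b c q)].
have AW x : A x -> W (coords b c x).
  by move=> [Ox /(slice_spaceP bc1) Ex]; rewrite /slice_domain /= Ex.
have conA : connected A by have [_ _] := sdO; apply.
have BA : B = A.
  apply: conA.
  - exists (embed b c p); split; last by rewrite embedK.
    by split; [exact: Wp|exact: embed_slice].
  - exists (coords b c @^-1` (W `&` flat D)).
      apply: open_comp (open_flat clif oW difference_solution).
      by move=> x _; exact: coords_continuous.
    apply/seteqP; split => x; first by move=> [Ax Fx]; split => //; split => //;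
      exact: AW.
    by move=> [Ax [_ Fx]].
  - exists (~` (coords b c @^-1` (W `\` flat D))).
      apply: open_closedC.
      apply: open_comp (open_not_flat clif oW difference_solution).
      by move=> x _; exact: coords_continuous.
    apply/seteqP; split => x; first by move=> [Ax Fx]; split => // -[_].
    move=> [Ax nF]; split => //; apply: contrapT => nFx; apply: nF; split => //.
    exact: AW.
have [[_ Jq] Fq] : B q by rewrite BA.
have Eq := (slice_spaceP bc1 q).1 Jq.
rewrite -Eq; apply/difference_eq0 => m; exact: (Fq [::] m).
Qed.

Lemma flat_of_interior S : S `<=` slice Omega J -> slice_interior J S !=set0 ->
  (forall q, S q -> f q = g q) -> exists2 p, W p & flat D p.
Proof.
move=> SO [q Sq] SE.
have SJ : S `<=` slice_space J by move=> x /SO[].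
have [Jq [U [oU Uq US]]] := (slice_interiorP q SJ).1 Sq.
pose P : set X := embed b c @^-1` U.
have PS x : P x -> S (embed b c x) by move=> Px; apply: US; split => //;
  exact: embed_slice.
have oP : open P by apply: open_comp oU => x _; exact: embed_continuous.
have PW : P `<=` W by move=> x /PS /SO[].
have Pq : P (coords b c q) by rewrite /P /= ((slice_spaceP bc1 q).1 Jq).
exists (coords b c q); first exact: PW.
apply: (flat_of_hyperplane (k0 := 0) clif oW difference_solution PW) Pq.
  move=> x k Px _; have [d d0 H] := open_ball_in oP Px.
  by exists d => // t td; apply: H; exact: ball_axis.
by move=> x m Px; apply: (difference_eq0 x).2; apply: SE; exact: PS.
Qed.

Lemma flat_of_hausdorff_dim S : S `<=` slice Omega J ->
  (2%:E < hausdorff_dim qdist S)%E ->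
  (forall q, S q -> f q = g q) -> exists2 p, W p & flat D p.
Proof.
move=> SO dimS SE.
have [//|nex] := pselect (exists2 p, W p & flat D p).
exfalso; move: dimS; apply/negP; rewrite -leNgt; apply: hausdorff_dim_le => // s s2.
pose P : set X := embed b c @^-1` S.
have PW : P `<=` W `\` flat D.
  move=> x Px; have Wx : W x by have [] := SO _ Px.
  by split => // Fx; apply: nex; exists x.
have S_P : S `<=` embed b c @` P.
  move=> q Sq; have [_ Jq] := SO q Sq; have Eq := (slice_spaceP bc1 q).1 Jq.
  by exists (coords b c q); rewrite /P /= ?Eq.
apply: hausdorff_null_subset S_P _.
apply: (not_flat_zero_set_null (embed_lipschitz bc1) ler01 s2 clif oW
  difference_solution PW).
by move=> x m Px; apply: (difference_eq0 x).2; exact: SE.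
Qed.

(** All the slice spaces share the complex plane, which is the hyperplane beta = 0 of
    each of them. *)
Lemma flat_of_plane z : Omega z -> complex_plane z ->
  (forall q, Omega q -> complex_plane q -> f q = g q) ->
  exists2 p, W p & flat D p.
Proof.
move=> Oz [x0 [x1 zE]] fg.
pose P : set X := W `&` [set x | x 0 2 = 0].
have PW : P `<=` W by move=> x [].
pose p : X := \row_k [:: x0; x1; 0]`_k.
have Ep : embed b c p = z by rewrite /embed !mxE /= scale0r addr0 zE.
have Pp : P p by split; [rewrite /slice_domain /= Ep|rewrite /= mxE].
exists p; first exact: PW.
apply: (flat_of_hyperplane (k0 := 2) clif oW difference_solution PW) Pp.
  move=> x k [Wx x2] k2; have [d d0 H] := open_ball_in oW Wx.
  exists d => // t td; split; first by apply: H; exact: ball_axis.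
  by rewrite /= !mxE eqxx/= x2 add0r eq_sym (negbTE k2) mulr0.
move=> x m [Wx x2]; apply: (difference_eq0 x).2; apply: fg => //.
by exists (x 0 0), (x 0 1); rewrite /embed x2 scale0r addr0.
Qed.

End OneSlice.

Lemma complex_plane_slice J : complex_plane `<=` slice_space (J : H).
Proof. by move=> q [a [b ->]]; exists a, b, 0; rewrite scale0r addr0. Qed.

Lemma mem_slice_space q : exists2 J : H, sphere1 J & slice_space J q.
Proof.
pose r := Num.sqrt (q 0 2 ^+ 2 + q 0 3 ^+ 2).
have S0 : 0 <= q 0 2 ^+ 2 + q 0 3 ^+ 2 by rewrite addr_ge0 ?sqr_ge0.
have r2 : r ^+ 2 = q 0 2 ^+ 2 + q 0 3 ^+ 2 by rewrite sqr_sqrtr.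
have qE : q = (q 0 0)%:A + q 0 1 *: qi + (q 0 2 *: qj + q 0 3 *: qk).
  by apply: quaternionP; rewrite /qi /qj /qk !(qDE, qZE) q1E !mkqE; ring.
have [r0|r0] := eqVneq r 0.
  exists qj; first by exists 1, 0; rewrite scale1r scale0r addr0 expr1n expr0n addr0.
  exists (q 0 0), (q 0 1), 0; rewrite {1}qE scale0r; congr (_ + _).
  have : q 0 2 ^+ 2 + q 0 3 ^+ 2 == 0 by rewrite -r2 r0 expr0n.
  rewrite paddr_eq0 ?sqr_ge0// !sqrf_eq0 => /andP[/eqP -> /eqP ->].
  by rewrite !scale0r addr0.
exists ((q 0 2 / r) *: qj + (q 0 3 / r) *: qk).
  exists (q 0 2 / r), (q 0 3 / r); split => //.
  by rewrite !expr_div_n -mulrDl -r2 divff// expf_neq0.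
exists (q 0 0), (q 0 1), r; rewrite {1}qE; congr (_ + _).
by rewrite scalerDr !scalerA ![r * _]mulrC !divfK.
Qed.

End Difference.

Theorem theorem4p14 (R : realType) (Omega : set (quaternion R))
    (f g : quaternion R -> quaternion R) :
  slice_domain13 Omega -> regular13 Omega f -> regular13 Omega g ->
  (exists (J0 : quaternion R) (S : set (quaternion R)),
    [/\ sphere1 J0,
        S `<=` slice Omega J0,
        slice_interior J0 S !=set0 \/ (2%:E < hausdorff_dim qdist S)%E
      & forall q, S q -> f q = g q]) ->
  forall q, Omega q -> f q = g q.
Proof.
move=> sdO rf rg [_ [S [[b0 [c0 [-> bc0]]] SO SD SE]]] q Oq.
have [p0 Wp0 Fp0] : exists2 p, slice_domain b0 c0 Omega p &
  flat (difference f g b0 c0) p.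
  by case: SD => [Si|Sh]; [exact: flat_of_interior Si SE|exact:
    flat_of_hausdorff_dim Sh SE].
have fg0 := slice_eq_of_flat sdO rf rg bc0 Wp0 Fp0.
have plane z : Omega z -> complex_plane z -> f z = g z.
  by move=> Oz Cz; apply: fg0; split => //; exact: complex_plane_slice.
have [J [b [c [JE bc]]] Jq] := mem_slice_space q.
have [_ [z [Oz Cz]] _] := sdO.
have [p Wp Fp] := flat_of_plane sdO rf rg bc Oz Cz plane.
by apply: (slice_eq_of_flat sdO rf rg bc Wp Fp); split => //; rewrite /unit_imag -JE.
Qed.
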